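(* Let $\alpha>0$ be a computable real number. Consider equations in the fixed list of operation symbols $F_i$ ($i\in\omega$), which contains each arity infinitely often. Then the set of pairs $(K,\Sigma)$, where $K$ is a finite simplicial complex, $\Sigma$ is a finite set of such equations, and $\lambda_{|K|}(\Sigma)<\alpha$, is recursively enumerable.
   Context: Equations and $\lambda$. Terms are built from variables $x_0,x_1,\dots$ and the operation symbols; an equation $\sigma\approx\tau$ is an ordered pair of terms. An algebra $\mathbf A=(A;\overline F_i)$ has operations $\overline F_i:A^{n_i}\to A$; each term $\sigma$ yields a term operation $\sigma^{\mathbf A}:A^\omega\to A$. For a nonempty metric space $(A,d)$ put $\lambda_{\mathbf A}(\Sigma)=\sup\{d(\sigma^{\mathbf A}(\mathbf a),\tau^{\mathbf A}(\mathbf a)):\sigma\approx\tau\in\Sigma,\ \mathbf a\in A^\omega\}$ (sup of the empty set is $0$), and $\lambda_A(\Sigma)=\inf\lambda_{\mathbf A}(\Sigma)$ over all algebras $\mathbf A$ on $A$ whose operations are continuous. The list $F_i$ ($i\in\omega$) of operation symbols has a recursive arity function $i\mapsto n_i$, and every arity occurs infinitely often; finite sets of equations in these symbols, and finite (nonempty) simplicial complexes (up to isomorphism, e.g. with vertices natural numbers), are coded by natural numbers in a standard effective way. A finite simplicial complex $K$ is a finite family of nonempty finite sets closed under nonempty subsets, with vertex set $V=\bigcup K$; $|K|$ is the set of $\beta\in[0,1]^V$ with $\sum_v\beta_v=1$ and $\{v:\beta_v>0\}\in K$, with the Euclidean metric $d(\beta,\gamma)=\sqrt{\sum_v(\beta_v-\gamma_v)^2}$.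 A real $\alpha$ is computable in the usual sense; all that is needed is that there is an algorithm deciding $s\alpha>r$ for positive integers $r,s$. *)

(* Defs.v *)
From HB Require Import structures.
From mathcomp Require Import all_boot all_order all_algebra finmap.
From mathcomp Require Import all_classical all_reals all_analysis.
From mathcomp Require Import ring.

Set Implicit Arguments.
Unset Strict Implicit.
Unset Printing Implicit Defensive.

Import Order.TTheory GRing.Theory Num.Theory.

Local Open Scope nat_scope.
Local Open Scope classical_set_scope.

(* The total recursive functions, as the least class containing the initial   *)
(* functions and closed under composition, primitive recursion and            *)
(* minimization of regular functions (the premise of [rec_min] says that the  *)
(* least zero exists and is computed by [g]).                                 *)
Inductive recursive : forall n, (n.-tuple nat -> nat) -> Prop :=
| rec_zero : recursive (fun _ : 0.-tuple nat => 0)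
| rec_succ : recursive (fun v : 1.-tuple nat => (thead v).+1)
| rec_proj n (i : 'I_n) : recursive (fun v : n.-tuple nat => tnth v i)
| rec_comp m n (f : m.-tuple nat -> nat) (g : 'I_m -> n.-tuple nat -> nat) :
    recursive f -> (forall i, recursive (g i)) ->
    recursive (fun v : n.-tuple nat => f [tuple g i v | i < m])
| rec_prim n (f : n.-tuple nat -> nat) (g : n.+2.-tuple nat -> nat)
    (h : n.+1.-tuple nat -> nat) :
    recursive f -> recursive g ->
    (forall v : n.-tuple nat, h [tuple of 0 :: v] = f v) ->
    (forall k (v : n.-tuple nat), h [tuple of k.+1 :: v] =
       g [tuple of k :: h [tuple of k :: v] :: v]) ->
    recursive h
| rec_min n (f : n.+1.-tuple nat -> nat) (g : n.-tuple nat -> nat) :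
    recursive f ->
    (forall v : n.-tuple nat, f [tuple of g v :: v] = 0 /\
       forall k, k < g v -> f [tuple of k :: v] <> 0) ->
    recursive g.

Definition recursive1 (f : nat -> nat) : Prop :=
  recursive (fun v : 1.-tuple nat => f (thead v)).

Definition recursively_enumerable (S : set nat) : Prop :=
  S = set0 \/ exists2 f : nat -> nat, recursive1 f & S = range f.

Definition computable_real (R : realType) (x : R) : Prop :=
  exists p q d : nat -> nat,
    [/\ recursive1 p, recursive1 q, recursive1 d &
      forall n, (`|x - ((p n)%:R - (q n)%:R) / (d n).+1%:R| <= 2%:R ^- n)%R].

Unset Elimination Schemes.
Inductive term (ar : nat -> nat) : Type :=
| Var of nat
| App (i : nat) of (term ar) ^ (ar i).
Set Elimination Schemes.

Lemma term_ind (ar : nat -> nat) (P : term ar -> Prop) :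
  (forall k, P (Var ar k)) ->
  (forall i (ts : (term ar) ^ (ar i)), (forall j, P (ts j)) -> P (App ts)) ->
  forall t, P t.
Proof.
by move=> Pvar Papp; fix IH 1 => -[k|i ts]; [exact: Pvar|apply: Papp => j; apply: IH].
Qed.

Fixpoint term_code (ar : nat -> nat) (t : term ar) : nat :=
  match t with
  | Var k => CodeSeq.code [:: 0; k]
  | App i ts => CodeSeq.code (i.+1 :: [seq term_code (ts j) | j <- enum 'I_(ar i)])
  end.

Lemma term_code_inj (ar : nat -> nat) : injective (@term_code ar).
Proof.
elim=> [k|i ts IH] [k'|i' ts'] /(can_inj CodeSeq.codeK) //; first by case=> ->.
case=> eqi; case: i' / eqi ts' => ts' /eq_in_map eq_ts.
congr App; apply/ffunP => j; apply: IH; apply: eq_ts.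
by rewrite mem_enum.
Qed.

HB.instance Definition _ (ar : nat -> nat) := gen_eqMixin (term ar).
HB.instance Definition _ (ar : nat -> nat) := gen_choiceMixin (term ar).

Definition equation (ar : nat -> nat) : Type := (term ar * term ar)%type.
HB.instance Definition _ (ar : nat -> nat) := Choice.on (equation ar).

Record complex : Type := Complex {
  faces :> {fset {fset nat}};
  faces_neq0 : faces != fset0;
  fset0_faces : fset0 \notin faces;
  faces_closed : forall s t : {fset nat},
    s \in faces -> (t `<=` s)%fset -> t != fset0 -> t \in faces }.

Definition vertices (K : complex) : {fset nat} := (\bigcup_(s <- K) s)%fset.

Section Realization.
Variables (R : realType) (K : complex).
Local Open Scope ring_scope.

Definition in_realization (b : {ffun vertices K -> R}) : bool :=
  [&& [forall v, 0 <= b v <= 1], \sum_v b v == 1 &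
      [fset val v | v : vertices K & 0 < b v]%fset \in faces K].

Record realization : Type := Realization {
  barycentric :> {ffun vertices K -> R};
  _ : in_realization barycentric }.

HB.instance Definition _ := [isSub for barycentric].
HB.instance Definition _ := [Choice of realization by <:].

Definition euclidean_dist (b c : realization) : R :=
  Num.sqrt (\sum_v (b v - c v) ^+ 2).

Let cauchy_schwarz (x y : {ffun vertices K -> R}) :
  (\sum_v x v * y v) ^+ 2 <= (\sum_v x v ^+ 2) * (\sum_v y v ^+ 2).
Proof.
have ge0 (z : {ffun vertices K -> R}) : 0 <= \sum_v z v ^+ 2.
  by apply: sumr_ge0 => v _; exact: sqr_ge0.
set X := \sum_v x v ^+ 2; set Y := \sum_v y v ^+ 2; set Z := \sum_v x v * y v.
have le0 : 0 <= Y * (X * Y - Z ^+ 2).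
  have := ge0 [ffun v => Y * x v - Z * y v].
  rewrite (eq_bigr (fun v => Y ^+ 2 * x v ^+ 2 + (Z ^+ 2 * y v ^+ 2
    + (- (Y * Z *+ 2)) * (x v * y v)))); last by move=> v _; rewrite ffunE; ring.
  rewrite !big_split -!mulr_sumr -/X -/Y -/Z /= => le0.
  by apply: le_trans le0 _; rewrite le_eqVlt; apply/orP; left; apply/eqP; ring.
have [Y0|Y0] := eqVneq Y 0; last first.
  by move: le0; rewrite pmulr_rge0 ?subr_ge0 // lt_def Y0 ge0.
suff -> : Z = 0 by rewrite expr0n mulr_ge0 ?ge0.
rewrite /Z big1 // => v _; have /eqP := psumr_eq0P (fun v _ => sqr_ge0 (y v)) Y0 (i := v) isT.
by rewrite sqrf_eq0 => /eqP ->; rewrite mulr0.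
Qed.

Let minkowski (x y : {ffun vertices K -> R}) :
  Num.sqrt (\sum_v (x v + y v) ^+ 2) <=
  Num.sqrt (\sum_v x v ^+ 2) + Num.sqrt (\sum_v y v ^+ 2).
Proof.
have ge0 (z : {ffun vertices K -> R}) : 0 <= \sum_v z v ^+ 2.
  by apply: sumr_ge0 => v _; exact: sqr_ge0.
rewrite -[leRHS]ger0_norm ?addr_ge0 ?sqrtr_ge0 // -sqrtr_sqr ler_wsqrtr //.
rewrite (eq_bigr (fun v => x v ^+ 2 + (x v * y v *+ 2 + y v ^+ 2))); last first.
  by move=> v _; ring.
rewrite !big_split /= sqrrD !sqr_sqrtr ?ge0 // addrA lerD2r lerD2l.
rewrite -mulr2n lerMn2r /= -sqrtrM ?ge0 // (le_trans (ler_norm _)) //.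
by rewrite -sqrtr_sqr ler_wsqrtr // cauchy_schwarz.
Qed.

Let dist_xx b : euclidean_dist b b = 0.
Proof.
by rewrite /euclidean_dist big1 ?sqrtr0 // => v _; rewrite subrr expr0n.
Qed.

Let dist_eq0 b c : euclidean_dist b c = 0 -> b = c.
Proof.
move=> /eqP; rewrite sqrtr_eq0 => le0; apply/val_inj/ffunP => v.
have sum0 : \sum_v (b v - c v) ^+ 2 = 0.
  by apply/eqP; rewrite eq_le le0 sumr_ge0 // => w _; exact: sqr_ge0.
have /eqP := psumr_eq0P (fun v _ => sqr_ge0 (b v - c v)) sum0 (i := v) isT.
by rewrite sqrf_eq0 subr_eq0 => /eqP.
Qed.

Let dist_sym b c : euclidean_dist b c = euclidean_dist c b.
Proof.
by rewrite /euclidean_dist; congr Num.sqrt; apply: eq_bigr => v _; ring.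
Qed.

Let dist_triangle c b d :
  euclidean_dist b d <= euclidean_dist b c + euclidean_dist c d.
Proof.
have := minkowski [ffun v => b v - c v] [ffun v => c v - d v].
rewrite /euclidean_dist; congr (Num.sqrt _ <= Num.sqrt _ + Num.sqrt _);
  apply: eq_bigr => v _; rewrite !ffunE //.
by congr (_ ^+ 2); ring.
Qed.

HB.instance Definition _ := isMetric.Build R realization
  dist_xx dist_eq0 dist_sym dist_triangle.

End Realization.

Section Lambda.
Variables (R : realType) (ar : nat -> nat) (A : metricType R).

(* Operations act on ['I_n -> A] with the product topology; this is the type  *)
(* of functions, on which the topology is visible only through the alias      *)
(* [prod_topology].                                                           *)
Definition power (n : nat) : topologicalType := prod_topology (fun _ : 'I_n => A).

Definition operations : Type := forall i : nat, power (ar i) -> A.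

Fixpoint term_op (F : operations) (t : term ar) (a : nat -> A) : A :=
  match t with
  | Var k => a k
  | App i ts => F i (fun j => term_op F (ts j) a)
  end.

Local Open Scope ereal_scope.

(* The point 0 only makes the supremum 0 when there is no equation.           *)
Definition lambda_algebra (F : operations) (Sigma : {fset equation ar}) : \bar R :=
  ereal_sup (0 |` [set x | exists e : equation ar, exists a : nat -> A,
    e \in Sigma /\ x = (mdist (term_op F e.1 a) (term_op F e.2 a))%:E]).

Definition lambda (Sigma : {fset equation ar}) : \bar R :=
  ereal_inf [set lambda_algebra F Sigma |
    F in [set F : operations | forall i, continuous (F i)]].

End Lambda.

(* The finite set {x_1, ..., x_k} is coded by 2 ^ c(x_1) + ... + 2 ^ c(x_k),  *)
(* where [c] codes its elements.                                              *)
Definition fset_code (T : choiceType) (c : T -> nat) (A : {fset T}) : nat :=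
  \sum_(x <- A) 2 ^ c x.

Definition complex_code (K : complex) : nat :=
  fset_code (fset_code id) (faces K).

Definition equation_code (ar : nat -> nat) (e : equation ar) : nat :=
  CodeSeq.code [:: term_code e.1; term_code e.2].

Definition pair_code (ar : nat -> nat) (p : complex * {fset equation ar}) : nat :=
  CodeSeq.code [:: complex_code p.1; fset_code (@equation_code ar) p.2].

Lemma fset_code_inj (T : choiceType) (c : T -> nat) :
  injective c -> injective (fset_code c).
Proof.
move=> c_inj.
have bit (k : nat) (s : seq nat) : uniq s ->
    odd ((\sum_(i <- s) 2 ^ i) %/ 2 ^ k) = (k \in s).
  elim: k s => [|k IH] s us.
    rewrite divn1; elim: s us => [|x s IHs] /=; first by rewrite big_nil.
    move=> /andP[xs us]; rewrite big_cons oddD oddX /= IHs // orbF inE.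
    by case: x xs => [|x] // /negPf ->.
  rewrite expnS divnMA.
  have -> : (\sum_(i <- s) 2 ^ i) %/ 2 = \sum_(i <- [seq i.-1 | i <- s & 0 < i]) 2 ^ i.
    rewrite big_map big_filter divn2.
    elim: s us => [|x s IHs] /=; first by rewrite !big_nil.
    move=> /andP[xs us]; rewrite !big_cons; case: x xs => [|x] xs /=.
      have od : odd (\sum_(i <- s) 2 ^ i) = false.
        elim: s xs us {IHs} => [|y s IHs] /=; first by rewrite big_nil.
        rewrite inE negb_or big_cons => /andP[y0 s0] /andP[_ us].
        by rewrite oddD oddX IHs // orbF addbF; case: y y0.
      by rewrite -IHs // add0n uphalf_half od.
    by rewrite -IHs // expnS mul2n halfD odd_double doubleK.
  rewrite IH; last first.
    rewrite map_inj_in_uniq ?filter_uniq //.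
    by move=> [|x] [|y]; rewrite !mem_filter //= => _ _ ->.
  apply/mapP/idP => [[[|x]]|ks]; rewrite ?mem_filter //=.
  - by move=> xs ->.
  - by exists k.+1; rewrite ?mem_filter.
move=> A B; rewrite /fset_code => eqAB; apply/fsetP => x.
have mem (C : {fset T}) : (x \in C) = odd ((\sum_(y <- C) 2 ^ c y) %/ 2 ^ c x).
  rewrite -(big_map c xpredT (fun i => 2 ^ i)) bit ?mem_map //.
  by rewrite map_inj_uniq ?fset_uniq.
by rewrite !mem eqAB.
Qed.

Lemma pair_code_inj (ar : nat -> nat) : injective (@pair_code ar).
Proof.
have eqn_inj : injective (@equation_code ar).
  by move=> [s t] [s' t'] /(can_inj CodeSeq.codeK)[] /term_code_inj -> /term_code_inj ->.
move=> [K S] [K' S'] /(can_inj CodeSeq.codeK)[].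
move=> /(fset_code_inj (fset_code_inj (@inj_id nat))) eqK /(fset_code_inj eqn_inj) ->.
case: K K' eqK => [f a b c] [f' a' b' c'] /= eqf; subst f'.
by congr (Complex _ _ _, _); exact: Prop_irrelevance.
Qed.

(* Main.v *)
(* Whether lambda(Sigma) < alpha on |K| is witnessed by finite data which can be
   checked by bounded search. Approximate |K| by the grid of its points whose
   barycentric coordinates are multiples of 1/N, and every operation by a table of
   values on grid points. If the values at neighbouring arguments always lie in a
   common simplex, the table extends to a continuous operation by a partition of
   unity, and the extension inherits the moduli of continuity which can be read off
   the table. By induction on terms, the values of the term operations are then
   known, up to explicit errors, from their evaluation on the grid, so that finitely
   many integer inequalities bound lambda(Sigma) by a rational R/N, and R/N < alpha
   is semidecidable.

   Conversely, continuous operations on the compact space |K| with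
   lambda(Sigma) < alpha are uniformly continuous. Cutting off the coordinates of
   their values at a small epsilon moves the values little, and sends values closer
   than epsilon to a common simplex, so that on a fine enough grid the rounded
   values are such a table. *)
Require Import Defs.
From mathcomp Require Import all_boot all_order all_algebra finmap.
From mathcomp Require Import all_classical all_reals all_analysis.
From mathcomp Require Import zify ring lra.

Set Implicit Arguments.
Unset Strict Implicit.
Unset Printing Implicit Defensive.

Import Order.TTheory GRing.Theory Num.Theory.
Import numFieldNormedType.Exports.

Local Open Scope nat_scope.

(** * Recursive functions *)

(** [|K|] is not convex, and arbitrarily close points may have incomparable supports: averaging
    table entries is legitimate only inside one face, and plain rounding would not provide that
    face. Hence the cut-off is a positive constant fixed before the mesh [1 / N]. Recursiveness has
    to be derived from the inductive definition, so the verifier is built from arithmetic, sequence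
    codes and bounded quantifiers. Evaluation of terms is therefore not programmed: the certificate
    lists all values, and each entry is tested against those of the immediate subterms. As a subterm
    has a smaller code than its term, one increasing sequence of errors indexed by codes serves all
    terms at once. Lengths are measured in units of [1 / N] and squared distances are compared,
    which leaves inequalities between natural numbers. *)

Definition recursive2 (f : nat -> nat -> nat) : Prop :=
  recursive (fun v : 2.-tuple nat => f (tnth v ord0) (tnth v (lift ord0 ord0))).

Definition recursive3 (f : nat -> nat -> nat -> nat) : Prop :=
  recursive (fun v : 3.-tuple nat => f (tnth v ord0) (tnth v (lift ord0 ord0))
    (tnth v (lift ord0 (lift ord0 ord0)))).

Lemma eq_recursive n (f g : n.-tuple nat -> nat) :
  f =1 g -> recursive f -> recursive g.
Proof. by move=> /funext ->. Qed.

Lemma recursive_comp1 n (f : nat -> nat) (g : n.-tuple nat -> nat) :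
  recursive1 f -> recursive g -> recursive (fun v => f (g v)).
Proof.
move=> rf rg; apply: eq_recursive (rec_comp rf (g := fun=> g) (fun=> rg)) => v.
by rewrite /thead tnth_mktuple.
Qed.

Lemma recursive_comp2 n (f : nat -> nat -> nat) (g h : n.-tuple nat -> nat) :
  recursive2 f -> recursive g -> recursive h ->
  recursive (fun v => f (g v) (h v)).
Proof.
move=> rf rg rh.
pose G (i : 'I_2) := if i == ord0 then g else h.
have rG i : recursive (G i) by rewrite /G; case: ifP.
by apply: eq_recursive (rec_comp rf rG) => v; rewrite !tnth_mktuple.
Qed.

Lemma recursive_const n c : recursive (fun _ : n.-tuple nat => c).
Proof.
elim: c => [|c IH]; last exact: (recursive_comp1 rec_succ IH).
by apply: eq_recursive (rec_comp rec_zero (g := fun=> fun=> 0) _) => // -[].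
Qed.

Lemma recursive2_prim (f : nat -> nat) (g : nat -> nat -> nat -> nat)
    (h : nat -> nat -> nat) :
  recursive1 f -> recursive3 g -> (forall x, h 0 x = f x) ->
  (forall k x, h k.+1 x = g k (h k x) x) -> recursive2 h.
Proof.
move=> rf rg h0 hS; apply: (rec_prim rf rg) => [v|k v].
  by rewrite tnth0 tnthS h0.
by rewrite !tnth0 !tnthS hS !tnth0.
Qed.

Lemma recursive1_id : recursive1 id.
Proof. exact: (rec_proj ord0). Qed.

Lemma recursive2_add : recursive2 addn.
Proof.
apply: (@recursive2_prim id (fun _ r _ => r.+1)) => //; first exact: recursive1_id.
by apply: (recursive_comp1 rec_succ); exact: rec_proj.
Qed.

Lemma recursive2_mul : recursive2 muln.
Proof.
apply: (@recursive2_prim (fun=> 0) (fun _ r x => x + r)) => //.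
- exact: recursive_const.
- by apply: (recursive_comp2 recursive2_add); exact: rec_proj.
Qed.

Lemma recursive1_pred : recursive1 predn.
Proof.
have rec2 : recursive2 (fun x _ => x.-1).
  apply: (@recursive2_prim (fun=> 0) (fun k _ _ => k)) => //.
    exact: recursive_const.
  exact: rec_proj.
exact: (recursive_comp2 rec2 recursive1_id recursive1_id).
Qed.

Lemma recursive2_sub : recursive2 subn.
Proof.
have rec2 : recursive2 (fun k x => x - k).
  apply: (@recursive2_prim id (fun _ r _ => r.-1)) => [||x|k x].
  - exact: recursive1_id.
  - by apply: (recursive_comp1 recursive1_pred); exact: rec_proj.
  - exact: subn0.
  - exact: subnS.
by apply: (@recursive_comp2 2 _ _ _ rec2); exact: rec_proj.
Qed.

Lemma recursive2_exp : recursive2 expn.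
Proof.
have rec2 : recursive2 (fun k x => x ^ k).
  apply: (@recursive2_prim (fun=> 1) (fun _ r x => x * r)) => [||//|k x].
  - exact: recursive_const.
  - by apply: (recursive_comp2 recursive2_mul); exact: rec_proj.
  - exact: expnS.
by apply: (@recursive_comp2 2 _ _ _ rec2); exact: rec_proj.
Qed.

Lemma rec_add (f g : nat -> nat) : recursive1 f -> recursive1 g ->
  recursive1 (fun c => f c + g c).
Proof. exact: (recursive_comp2 recursive2_add). Qed.

Lemma rec_mul (f g : nat -> nat) : recursive1 f -> recursive1 g ->
  recursive1 (fun c => f c * g c).
Proof. exact: (recursive_comp2 recursive2_mul). Qed.

Lemma rec_sub (f g : nat -> nat) : recursive1 f -> recursive1 g ->
  recursive1 (fun c => f c - g c).
Proof. exact: (recursive_comp2 recursive2_sub). Qed.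

Lemma rec_exp (f g : nat -> nat) : recursive1 f -> recursive1 g ->
  recursive1 (fun c => f c ^ g c).
Proof. exact: (recursive_comp2 recursive2_exp). Qed.

Lemma rec_S (f : nat -> nat) : recursive1 f -> recursive1 (fun c => (f c).+1).
Proof. exact: (recursive_comp1 rec_succ). Qed.

Lemma rec_cst n : recursive1 (fun=> n).
Proof. exact: recursive_const. Qed.

Lemma rec_fun (f g : nat -> nat) : recursive1 f -> recursive1 g ->
  recursive1 (fun c => f (g c)).
Proof. exact: recursive_comp1. Qed.

(** As [x <= x + y], the value lies between [(x + y) ^ 2] and [(x + y).+1 ^ 2], so an integer square
    root recovers [x + y], and then [x] and [y]. *)
Definition npair x y := (x + y) ^ 2 + x.

Fact isqrt_subproof z : exists s, z < s.+1 ^ 2.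
Proof. by exists z; rewrite -mulnn; lia. Qed.

Definition isqrt z := ex_minn (isqrt_subproof z).
Definition nfst z := z - isqrt z ^ 2.
Definition nsnd z := isqrt z - nfst z.

Lemma isqrt_npair x y : isqrt (npair x y) = x + y.
Proof.
rewrite /isqrt /npair; case: ex_minnP => s lts mins.
apply/eqP; rewrite eqn_leq mins /=; last first.
  by rewrite -!mulnn; nia.
by rewrite -ltnS -ltn_sqr (leq_ltn_trans _ lts) // leq_addr.
Qed.

Lemma npairK1 x y : nfst (npair x y) = x.
Proof. by rewrite /nfst isqrt_npair /npair addKn. Qed.

Lemma npairK2 x y : nsnd (npair x y) = y.
Proof. by rewrite /nsnd npairK1 isqrt_npair addKn. Qed.

Lemma recursive1_isqrt : recursive1 isqrt.
Proof.
(* The minimized function of [s] and [z] vanishes exactly when [z < s.+1 ^ 2]. This is the one place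
   where minimization is used. *)
apply: (rec_min (f := fun v => 1 - (((tnth v ord0).+1) ^ 2
    - (tnth v (lift ord0 ord0))))) => [|v].
- apply: (recursive_comp2 recursive2_sub); first exact: recursive_const.
  apply: (recursive_comp2 recursive2_sub); last exact: rec_proj.
  apply: (recursive_comp2 recursive2_exp); last exact: recursive_const.
  by apply: (recursive_comp1 rec_succ); exact: rec_proj.
- rewrite !tnth0 !tnthS /thead /isqrt; case: ex_minnP => s lts mins; split; first lia.
  move=> k kls; rewrite !tnth0 !tnthS; move/contra: (mins k); rewrite -!ltnNge => /(_ kls).
  lia.
Qed.

Lemma rec_nfst (f : nat -> nat) : recursive1 f -> recursive1 (fun c => nfst (f c)).
Proof.
move=> rf; apply: rec_sub => //; apply: rec_exp; last exact: rec_cst.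
exact: rec_fun recursive1_isqrt rf.
Qed.

Lemma rec_nsnd (f : nat -> nat) : recursive1 f -> recursive1 (fun c => nsnd (f c)).
Proof.
move=> rf; apply: rec_sub; last exact: rec_nfst.
exact: rec_fun recursive1_isqrt rf.
Qed.

(* A function of several arguments is handled as a unary function of a        *)
(* context which stores the arguments in nested pairs.                        *)
Lemma rec_nat_rect (m f : nat -> nat) (g : nat -> nat -> nat -> nat) :
  recursive1 m -> recursive1 f ->
  recursive1 (fun c => g (nfst c) (nfst (nsnd c)) (nsnd (nsnd c))) ->
  recursive1 (fun c => nat_rect (fun=> nat) (f c) (g c) (m c)).
Proof.
move=> rm rf rg.
have rpair n (h k : n.-tuple nat -> nat) : recursive h -> recursive k ->
    recursive (fun v => npair (h v) (k v)).
  move=> rh rk; apply: (recursive_comp2 recursive2_add) => //.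
  apply: (recursive_comp2 recursive2_exp); last exact: recursive_const.
  exact: (recursive_comp2 recursive2_add).
have rec2 : recursive2 (fun k x => nat_rect (fun=> nat) (f x) (g x) k).
  apply: (@recursive2_prim f (fun k r x => g x k r)) => //.
  have := recursive_comp1 rg (rpair 3 _ _ (rec_proj (lift ord0 (lift ord0 ord0)))
    (rpair 3 _ _ (rec_proj ord0) (rec_proj (lift ord0 ord0)))).
  by apply: eq_recursive => v; rewrite !(npairK1, npairK2).
exact: (recursive_comp2 rec2 rm recursive1_id).
Qed.

Lemma eq_recursive1 (f g : nat -> nat) : f =1 g -> recursive1 f -> recursive1 g.
Proof. by move=> /funext ->. Qed.

Lemma rec_iter (m f : nat -> nat) (h : nat -> nat) :
  recursive1 m -> recursive1 f -> recursive1 h ->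
  recursive1 (fun c => iter (m c) h (f c)).
Proof.
move=> rm rf rh.
apply: (@eq_recursive1 (fun c => nat_rect (fun=> nat) (f c) (fun _ r => h r) (m c))).
  by move=> c; elim: (m c) => //= k ->.
apply: (@rec_nat_rect m f (fun _ _ r => h r)) => //.
exact/rec_fun/rec_nsnd/rec_nsnd/recursive1_id.
Qed.

Definition sum_lt n (F : nat -> nat) := \sum_(i < n) F i.

Lemma rec_sum_lt (m : nat -> nat) (F : nat -> nat -> nat) :
  recursive1 m -> recursive1 (fun c => F (nfst c) (nsnd c)) ->
  recursive1 (fun c => sum_lt (m c) (F c)).
Proof.
move=> rm rF.
apply: (@eq_recursive1 (fun c => nat_rect (fun=> nat) 0 (fun k r => r + F c k) (m c))).
  move=> c; rewrite /sum_lt.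
  by elim: (m c) => [|k IH] /=; rewrite ?big_ord0 // big_ord_recr /= -IH.
apply: (@rec_nat_rect m (fun=> 0) (fun c k r => r + F c k)) => //; first exact: rec_cst.
apply: rec_add; first exact/rec_nsnd/rec_nsnd/recursive1_id.
pose P c := npair (nfst c) (nfst (nsnd c)).
have rP : recursive1 P.
  apply: rec_add; last exact: rec_nfst recursive1_id.
  apply: rec_exp; last exact: rec_cst.
  apply: rec_add; first exact: rec_nfst recursive1_id.
  exact/rec_nfst/rec_nsnd/recursive1_id.
apply: eq_recursive1 (rec_fun rF rP) => c.
by rewrite /P npairK1 npairK2.
Qed.

Lemma rec_leq (f g : nat -> nat) : recursive1 f -> recursive1 g ->
  recursive1 (fun c => f c <= g c).
Proof.
move=> rf rg; apply: eq_recursive1 (rec_sub (rec_cst 1) (rec_sub rf rg)) => c.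
by rewrite -subn_eq0; case: (f c - g c).
Qed.

Lemma rec_eq (f g : nat -> nat) : recursive1 f -> recursive1 g ->
  recursive1 (fun c => f c == g c).
Proof.
move=> rf rg; apply: eq_recursive1 (rec_mul (rec_leq rf rg) (rec_leq rg rf)) => c.
by rewrite mulnb eqn_leq.
Qed.

Lemma rec_and (p q : nat -> bool) :
  recursive1 (fun c => p c) -> recursive1 (fun c => q c) ->
  recursive1 (fun c => p c && q c).
Proof. by move=> rp rq; apply: eq_recursive1 (rec_mul rp rq) => c; rewrite mulnb. Qed.

Lemma rec_not (p : nat -> bool) :
  recursive1 (fun c => p c) -> recursive1 (fun c => ~~ p c).
Proof. by move=> rp; apply: eq_recursive1 (rec_sub (rec_cst 1) rp) => c; case: (p c). Qed.

Lemma rec_or (p q : nat -> bool) :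
  recursive1 (fun c => p c) -> recursive1 (fun c => q c) ->
  recursive1 (fun c => p c || q c).
Proof.
move=> rp rq; apply: eq_recursive1 (rec_not (rec_and (rec_not rp) (rec_not rq))) => c.
by case: (p c); case: (q c).
Qed.

Lemma rec_imp (p q : nat -> bool) :
  recursive1 (fun c => p c) -> recursive1 (fun c => q c) ->
  recursive1 (fun c => p c ==> q c).
Proof.
move=> rp rq; apply: eq_recursive1 (rec_or (rec_not rp) rq) => c.
by case: (p c).
Qed.

Lemma rec_if (p : nat -> bool) (f g : nat -> nat) :
  recursive1 (fun c => p c) -> recursive1 f -> recursive1 g ->
  recursive1 (fun c => if p c then f c else g c).
Proof.
move=> rp rf rg.
apply: eq_recursive1 (rec_add (rec_mul rp rf) (rec_mul (rec_not rp) rg)) => c.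
by case: (p c); rewrite /= ?mul1n ?mul0n ?addn0.
Qed.

Definition forall_lt n (P : nat -> bool) := all P (iota 0 n).
Definition exists_lt n (P : nat -> bool) := has P (iota 0 n).

Lemma forall_ltP n (P : nat -> bool) : reflect (forall i, i < n -> P i) (forall_lt n P).
Proof. by apply: (iffP allP) => H i => [lti|]; [apply: H|]; rewrite mem_iota //; apply: H. Qed.

Lemma exists_ltP n (P : nat -> bool) : reflect (exists2 i, i < n & P i) (exists_lt n P).
Proof.
apply: (iffP hasP) => -[i]; rewrite ?mem_iota => lti Pi; exists i => //.
by rewrite mem_iota.
Qed.

Lemma rec_forall_lt (m : nat -> nat) (P : nat -> nat -> bool) :
  recursive1 m -> recursive1 (fun c => P (nfst c) (nsnd c)) ->
  recursive1 (fun c => forall_lt (m c) (P c)).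
Proof.
move=> rm rP.
(* The sum counts the counterexamples. *)
have rS := @rec_sum_lt m (fun c i => ~~ P c i) rm (rec_not rP).
apply: eq_recursive1 (rec_eq rS (rec_cst 0)) => c.
rewrite /sum_lt sum_nat_eq0; congr nat_of_bool; apply/forallP/forall_ltP => H i.
  by move=> lti; have := H (Ordinal lti); case: (P c i).
by rewrite H.
Qed.

Lemma rec_exists_lt (m : nat -> nat) (P : nat -> nat -> bool) :
  recursive1 m -> recursive1 (fun c => P (nfst c) (nsnd c)) ->
  recursive1 (fun c => exists_lt (m c) (P c)).
Proof.
move=> rm rP; have rN := @rec_forall_lt m (fun c i => ~~ P c i) rm (rec_not rP).
apply: eq_recursive1 (rec_not rN) => c; congr nat_of_bool.
by rewrite /forall_lt /exists_lt; elim: (iota 0 (m c)) => //= i s <-; case: (P c i).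
Qed.

(** * Sequences coded by numbers *)

Lemma sum_ltn n m : m <= n -> \sum_(i < n) (i < m) = m.
Proof.
elim: n => [|n IH]; first by rewrite leqn0 => /eqP ->; rewrite big_ord0.
rewrite big_ord_recr leq_eqVlt => /orP[/eqP ->|lt] /=.
  by rewrite (eq_bigr (fun=> 1)) ?sum_nat_const ?card_ord ?ltnSn ?muln1 ?addn1 //
    => i _; rewrite (leq_trans (ltn_ord i)).
by rewrite IH // ltnNge -ltnS lt addn0.
Qed.

Lemma rec_divn (f g : nat -> nat) : recursive1 f -> recursive1 g ->
  recursive1 (fun c => f c %/ g c).
Proof.
move=> rf rg.
(* The quotient is the number of positive multiples of [g c] up to [f c]; the guard [0 < g c] yields
   the conventional value 0 for a zero divisor. *)
have rS := @rec_sum_lt f (fun c q => (0 < g c) && (q.+1 * g c <= f c)) rf.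
apply: eq_recursive1 (rS _) => [c|]; last first.
  apply: rec_and.
    apply: rec_leq; first exact: rec_cst.
    exact/(rec_fun rg)/rec_nfst/recursive1_id.
  apply: rec_leq; last exact/(rec_fun rf)/rec_nfst/recursive1_id.
  apply: rec_mul; first exact/rec_S/rec_nsnd/recursive1_id.
  exact/(rec_fun rg)/rec_nfst/recursive1_id.
have [->|g0] := posnP (g c); first by rewrite divn0 /sum_lt big1.
rewrite /sum_lt (eq_bigr (fun i : 'I_(f c) => (i < f c %/ g c) : nat)); last first.
  by move=> i _; rewrite leq_divRL.
by rewrite sum_ltn // leq_div.
Qed.

(** Recursiveness is read off the syntax. Each bounded sum or quantifier turns the context into a
    pair: its bound variable becomes [nsnd c], and the former context [nfst c]. *)
Ltac rec_step := lazymatch goal with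
  | |- recursive1 (fun c => nfst (@?f c)) => apply (@rec_nfst f)
  | |- recursive1 (fun c => nsnd (@?f c)) => apply (@rec_nsnd f)
  | |- recursive1 (fun c => c) => exact recursive1_id
  | |- recursive1 (fun _ => ?n) => exact (rec_cst n)
  | |- recursive1 (fun c => @?f c + @?g c) => apply (@rec_add f g)
  | |- recursive1 (fun c => @?f c - @?g c) => apply (@rec_sub f g)
  | |- recursive1 (fun c => @?f c * @?g c) => apply (@rec_mul f g)
  | |- recursive1 (fun c => @?f c ^ @?g c) => apply (@rec_exp f g)
  | |- recursive1 (fun c => @?f c %/ @?g c) => apply (@rec_divn f g)
  | |- recursive1 (fun c => sum_lt (@?m c) (@?F c)) => apply (@rec_sum_lt m F)
  | |- recursive1 (fun c => (@?f c).+1) => apply (@rec_S f)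
  | |- recursive1 (fun c => nat_of_bool (@?p c && @?q c)) => apply (@rec_and p q)
  | |- recursive1 (fun c => nat_of_bool (@?p c || @?q c)) => apply (@rec_or p q)
  | |- recursive1 (fun c => nat_of_bool (@?p c ==> @?q c)) => apply (@rec_imp p q)
  | |- recursive1 (fun c => nat_of_bool (~~ @?p c)) => apply (@rec_not p)
  | |- recursive1 (fun c => nat_of_bool (@?f c <= @?g c)) => apply (@rec_leq f g)
  | |- recursive1 (fun c => nat_of_bool (@?f c == @?g c)) => apply (@rec_eq f g)
  | |- recursive1 (fun c => nat_of_bool (forall_lt (@?m c) (@?P c))) => apply (@rec_forall_lt m P)
  | |- recursive1 (fun c => nat_of_bool (exists_lt (@?m c) (@?P c))) => apply (@rec_exists_lt m P)
  | rf : recursive1 ?f |- recursive1 ?f => exact rf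
  | rf : recursive1 ?f |- recursive1 (fun c => ?f (@?g c)) => apply (@rec_fun f g rf)
  end; cbv beta.

Lemma rec_odd (f : nat -> nat) : recursive1 f -> recursive1 (fun c => odd (f c)).
Proof.
move=> rf; apply: (@eq_recursive1 (fun c => f c - f c %/ 2 * 2)); last by repeat rec_step.
by move=> c; rewrite -modn2 {1}(divn_eq (f c) 2) addKn.
Qed.

Definition bit n i := odd (n %/ 2 ^ i).

Lemma rec_bit (f g : nat -> nat) : recursive1 f -> recursive1 g ->
  recursive1 (fun c => bit (f c) (g c)).
Proof. by move=> rf rg; apply: rec_odd; repeat rec_step. Qed.

Lemma rec_log2 (f : nat -> nat) : recursive1 f -> recursive1 (fun c => logn 2 (f c)).
Proof.
move=> rf.
have dvdE n x : (2 ^ x.+1 %| n) = exists_lt n.+1 (fun q => n == q * 2 ^ x.+1).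
  apply/dvdnP/exists_ltP => [[q nE]|[q _ /eqP ->]]; last by exists q.
  by exists q; rewrite ?nE // ltnS leq_pmulr // expn_gt0.
(* [logn 2 n] counts the positive exponents whose power of 2 divides [n]; for [n = 0] the empty sum
   agrees with [logn 2 0 = 0]. *)
apply: (@eq_recursive1 (fun c => sum_lt (f c)
    (fun x => exists_lt (f c).+1 (fun q => f c == q * 2 ^ x.+1)))); last by repeat rec_step.
move=> c; rewrite /sum_lt; have [->|f0] := posnP (f c); first by rewrite big_ord0.
rewrite (eq_bigr (fun i : 'I_(f c) => (i < logn 2 (f c)) : nat)); last first.
  by move=> i _; rewrite -dvdE pfactor_dvdn.
by rewrite sum_ltn // ltnW // ltn_logl.
Qed.

(* Arithmetical counterparts, on the values of [CodeSeq.code], of the         *)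
(* operations on sequences; [code_nth] returns 0 outside of the sequence.     *)
Definition code_cons a s := 2 ^ a * (s * 2).+1.
Definition code_tail s := s %/ 2 ^ (logn 2 s).+1.
Definition code_nth s j := logn 2 (iter j code_tail s).
Definition code_size n s :=
  (iter n code_tail s == 0) && forall_lt n (fun j => ~~ (iter j code_tail s == 0)).

Lemma code_consE a s : CodeSeq.code (a :: s) = code_cons a (CodeSeq.code s).
Proof. by rewrite /code_cons muln2. Qed.

Lemma logn_code_cons a s : logn 2 (code_cons a s) = a.
Proof.
rewrite /code_cons lognM ?expn_gt0 // pfactorK // lognE /= dvdn2 /= muln2 odd_double.
by rewrite addn0.
Qed.

Lemma code_tail_cons a s : code_tail (code_cons a s) = s.
Proof.
rewrite /code_tail logn_code_cons /code_cons expnS [2 * _]mulnC divnMA mulKn ?expn_gt0 //.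
by rewrite muln2 divn2 /= uphalf_double.
Qed.

Lemma code_tail0 : code_tail 0 = 0.
Proof. exact: div0n. Qed.

Lemma code_drop j s : iter j code_tail (CodeSeq.code s) = CodeSeq.code (drop j s).
Proof.
elim: j s => [|j IH] [|a s] //; first by rewrite iterS IH code_tail0.
by rewrite iterSr code_consE code_tail_cons IH.
Qed.

Lemma code_nth_code s j : code_nth (CodeSeq.code s) j = nth 0 s j.
Proof.
rewrite /code_nth code_drop -{2}[j]addn0 -nth_drop; case: (drop j s) => [|a t].
  by rewrite logn0.
by rewrite code_consE logn_code_cons.
Qed.

Lemma code_eq0 s : (CodeSeq.code s == 0) = nilp s.
Proof. by case: s => // a s; rewrite code_consE muln_eq0 expn_eq0. Qed.

Lemma code_size_code n s : code_size n (CodeSeq.code s) = (size s == n).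
Proof.
rewrite /code_size code_drop code_eq0 /nilp size_drop subn_eq0.
apply/andP/eqP => [[le /forall_ltP H]|<-]; last first.
  by split => //; apply/forall_ltP => j ltj; rewrite code_drop code_eq0 /nilp size_drop subn_eq0 -ltnNge.
apply/eqP; rewrite eqn_leq le leqNgt; apply/negP => lt.
by have := H _ lt; rewrite code_drop drop_size.
Qed.

(** Every number codes a sequence, so a number is determined by its size and entries. *)
Lemma code_tuple n s : code_size n s -> s = CodeSeq.code (mkseq (code_nth s) n).
Proof.
rewrite -{1 2}[s]CodeSeq.decodeK code_size_code => /eqP size_s; congr CodeSeq.code.
apply: (@eq_from_nth _ 0); rewrite ?size_mkseq // => i; rewrite size_s => lti.
by rewrite nth_mkseq // -{2}[s]CodeSeq.decodeK code_nth_code.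
Qed.

(** In binary, [code_cons a s] is [s] followed by a digit 1 and [a] zeros, so an entry at most [x]
    takes at most [x.+1] digits. *)
Definition code_bound x n := 2 ^ (x.+1 * n).

Lemma code_lt_bound x s : (forall a, a \in s -> a <= x) ->
  CodeSeq.code s < code_bound x (size s).
Proof.
rewrite /code_bound; elim: s => [|a s IH] H /=; first by rewrite muln0.
rewrite [x.+1 * _]mulnS expnD -/CodeSeq.code.
have {}IH : CodeSeq.code s < 2 ^ (x.+1 * size s).
  by apply: IH => b bs; apply: H; rewrite inE bs orbT.
have ax : a <= x by apply: H; rewrite inE eqxx.
apply: (@leq_trans (2 ^ a.+1 * (CodeSeq.code s).+1)).
  by rewrite expnSr -mulnA ltn_pmul2l ?expn_gt0 //; lia.
by apply: leq_mul => //; rewrite leq_exp2l.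
Qed.

Lemma rec_code_cons (f g : nat -> nat) : recursive1 f -> recursive1 g ->
  recursive1 (fun c => code_cons (f c) (g c)).
Proof. by move=> rf rg; rewrite /code_cons; repeat rec_step. Qed.

Lemma rec_code_drop (f g : nat -> nat) : recursive1 f -> recursive1 g ->
  recursive1 (fun c => iter (f c) code_tail (g c)).
Proof.
move=> rf rg; apply: rec_iter => //; rewrite /code_tail.
have rlog := rec_log2 recursive1_id; rewrite /= in rlog.
by repeat rec_step.
Qed.

Lemma rec_code_nth (f g : nat -> nat) : recursive1 f -> recursive1 g ->
  recursive1 (fun c => code_nth (f c) (g c)).
Proof. by move=> rf rg; apply/rec_log2/rec_code_drop. Qed.

Lemma rec_code_size (f g : nat -> nat) : recursive1 f -> recursive1 g ->
  recursive1 (fun c => code_size (f c) (g c)).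
Proof.
move=> rf rg; apply: rec_and.
  by apply: rec_eq; [exact: rec_code_drop|exact: rec_cst].
apply: rec_forall_lt => //; apply: rec_not; apply: rec_eq; last exact: rec_cst.
by apply: (@rec_code_drop (fun c => nsnd c) (fun c => g (nfst c))); repeat rec_step.
Qed.

Lemma rec_code_bound (f g : nat -> nat) : recursive1 f -> recursive1 g ->
  recursive1 (fun c => code_bound (f c) (g c)).
Proof. by move=> rf rg; rewrite /code_bound; repeat rec_step. Qed.

(** * Certificates *)

(* A certificate for the pair coded by [k] and [S] consists of the numbers    *)
(* [N f W E M R n]. The code [x] of a sequence of [k] numbers of sum [N], with *)
(* support in a face, stands for the point of the realization with            *)
(* barycentric coordinates [code_nth x v / N]; all vertices are below [k].    *)
(* All symbols, variables and terms occurring in the equations have codes     *)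
(* below [S], so [S] also bounds the number of variables of an assignment.    *)
(* - [f] lists the tables of values of the operations on the grid points;     *)
(* - [W] marks the codes of terms, and [E] lists their values on the grid;    *)
(* - [M] lists errors, in units of [1 / N]: an error [M_t] in the arguments of *)
(*   an operation results in an error [M_(t+1)] in its value, so that the value *)
(*   of the term of code [t] is known up to [M_t];                            *)
(* - [R / N] bounds the distances between the two sides of the equations, and *)
(*   [n] is the precision at which [R / N < alpha] becomes visible.           *)
Definition supp_in k x s := forall_lt k (fun v => (0 < code_nth x v) ==> bit s v).

(** Entries from position [k] on are ignored, so a grid point may have several codes. The tables may
    treat these differently: [check_modulus] also compares tuples of different codes of the same
    points. *)
Definition is_point k N x :=
  [&& x < code_bound N k, sum_lt k (fun v => code_nth x v) == N &
  exists_lt k (fun s => bit k s && supp_in k x s)].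

Definition is_tuple k N n h := forall_lt n (fun j => is_point k N (code_nth h j)).

Definition tuple_bound k N n := code_bound (code_bound N k) n.

Definition tuples_near k n d h h' := forall_lt n (fun j => forall_lt k (fun v =>
  (code_nth (code_nth h j) v <= code_nth (code_nth h' j) v + d) &&
  (code_nth (code_nth h' j) v <= code_nth (code_nth h j) v + d))).

(** The number 0 codes the empty set. The bound on [s'] misses no subset, since the code of a subset
    is at most that of the set. *)
Definition check_complex k :=
  [&& 0 < k, ~~ bit k 0 & forall_lt k (fun s => bit k s ==> forall_lt k (fun s' =>
    (0 < s') && forall_lt k (fun v => bit s' v ==> bit s v) ==> bit k s'))].

(** Every argument is within [k] units of some grid tuple [h], and the tuples [h'] of positive
    weight there are within [k + 1] units of it; so they are within [2 * k + 1] of [h]. *)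
Definition check_simplex k N n f :=
  forall_lt (tuple_bound k N n) (fun h => is_tuple k N n h ==>
    is_point k N (code_nth f h) &&
    exists_lt k (fun s => bit k s && forall_lt (tuple_bound k N n) (fun h' =>
      is_tuple k N n h' && tuples_near k n (2 * k + 1) h h' ==>
      supp_in k (code_nth f h') s))).

(** An argument known up to [d] from [h] gives positive weight only to tuples less than [k + 1] away
    from it, hence within [d + k + 1] of [h]. One inequality suffices, as [h] and [h'] may be
    exchanged. *)
Definition check_modulus k N n f d e :=
  forall_lt (tuple_bound k N n) (fun h => forall_lt (tuple_bound k N n) (fun h' =>
    [&& is_tuple k N n h, is_tuple k N n h' & tuples_near k n (d + k + 1) h h'] ==>
    forall_lt k (fun v => code_nth (code_nth f h) v <= code_nth (code_nth f h') v + e))).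

(** [M_0] must cover the error [k] of rounding an assignment. The arguments in a term of code [t]
    have codes at most [t - 1], hence by monotonicity errors at most [M_(t-1)]. *)
Definition check_operations (ar : nat -> nat) k S N f M :=
  [&& k <= code_nth M 0,
      forall_lt S (fun t => code_nth M t <= code_nth M t.+1) &
      forall_lt S (fun i => check_simplex k N (ar i) (code_nth f i) &&
        forall_lt S (fun t =>
          check_modulus k N (ar i) (code_nth f i) (code_nth M t) (code_nth M t.+1)))].

(** The leading entry of a code distinguishes variables from applications. The searches may stop at
    [t] because a code exceeds its entries and its tail; [u] codes the tuple of values of the
    arguments. *)
Definition check_term (ar : nat -> nat) k S N f W E t :=
  exists_lt t (fun x => (t == code_cons 0 (code_cons x 0)) &&
    forall_lt (tuple_bound k N S) (fun h => is_tuple k N S h ==>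
      (code_nth (code_nth E t) h == code_nth h x))) ||
  exists_lt t (fun i => exists_lt t (fun s =>
    [&& t == code_cons i.+1 s, code_size (ar i) s,
        forall_lt (ar i) (fun j => 0 < code_nth W (code_nth s j)) &
        forall_lt (tuple_bound k N S) (fun h => is_tuple k N S h ==>
          exists_lt (tuple_bound k N (ar i)) (fun u =>
            forall_lt (ar i) (fun j =>
              code_nth u j == code_nth (code_nth E (code_nth s j)) h) &&
            (code_nth (code_nth E t) h == code_nth (code_nth f i) u)))])).

Definition check_terms (ar : nat -> nat) k S N f W E :=
  forall_lt S (fun t => (0 < code_nth W t) ==> check_term ar k S N f W E t).

(** The two truncated subtractions add up to the absolute difference of the coordinates; [2 * m]
    allows for an error [m] on either side. *)
Definition check_distance k N S m R E s t :=
  forall_lt (tuple_bound k N S) (fun h => is_tuple k N S h ==>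
    (sum_lt k (fun v =>
       (code_nth (code_nth (code_nth E s) h) v - code_nth (code_nth (code_nth E t) h) v
      + (code_nth (code_nth (code_nth E t) h) v - code_nth (code_nth (code_nth E s) h) v)
      + 2 * m) ^ 2) <= R ^ 2)).

(** This also certifies that [S] codes a set of equations: each of its bits must be a pair of marked
    term codes. *)
Definition check_equations k S N W E m R :=
  forall_lt S (fun e => bit S e ==> exists_lt e (fun s => exists_lt e (fun t =>
    [&& e == code_cons s (code_cons t 0), 0 < code_nth W s, 0 < code_nth W t &
        check_distance k N S m R E s t]))).

(** This is [R / N + 2 ^- n < (p n - q n) / (d n).+1] with denominators cleared and the subtraction
    moved across. *)
Definition check_bound (p q d : nat -> nat) N R n :=
  (0 < N) && (R * (d n).+1 * 2 ^ n + N * (d n).+1 + N * q n * 2 ^ n < N * p n * 2 ^ n).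

Definition check (ar p q d : nat -> nat) k S N f W E M R n :=
  [&& check_complex k, check_operations ar k S N f M, check_terms ar k S N f W E,
      check_equations k S N W E (code_nth M S) R & check_bound p q d N R n].

Definition check_code (ar p q d : nat -> nat) c :=
  check ar p q d (code_nth c 0) (code_nth c 1) (code_nth c 2) (code_nth c 3)
    (code_nth c 4) (code_nth c 5) (code_nth c 6) (code_nth c 7) (code_nth c 8).

Ltac rec_auto := repeat lazymatch goal with
  | |- recursive1 (fun c => nat_of_bool (bit (@?f c) (@?g c))) => apply (@rec_bit f g); cbv beta
  | |- recursive1 (fun c => nat_of_bool (code_size (@?f c) (@?g c))) =>
      apply (@rec_code_size f g); cbv beta
  | |- recursive1 (fun c => code_nth (@?f c) (@?g c)) => apply (@rec_code_nth f g); cbv beta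
  | |- recursive1 (fun c => code_cons (@?f c) (@?g c)) => apply (@rec_code_cons f g); cbv beta
  | |- recursive1 (fun c => code_bound (@?f c) (@?g c)) => apply (@rec_code_bound f g); cbv beta
  | |- _ => rec_step
  end.

Lemma rec_check_code (ar p q d : nat -> nat) :
  recursive1 ar -> recursive1 p -> recursive1 q -> recursive1 d ->
  recursive1 (fun c => check_code ar p q d c).
Proof.
move=> rar rp rq rd.
rewrite /check_code /check /check_complex /check_operations /check_terms /check_term.
rewrite /check_equations /check_distance /check_simplex /check_modulus /check_bound.
rewrite /tuples_near /is_tuple /is_point /supp_in /tuple_bound.
by rec_auto.
Qed.

Lemma recursively_enumerable_check (S : set nat) (P : nat -> bool) (out : nat -> nat) :
  recursive1 (fun c => P c) -> recursive1 out ->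
  (forall c, P c -> S (out c)) -> (forall x, S x -> exists2 c, P c & out c = x) ->
  recursively_enumerable S.
Proof.
move=> rP rout sound complete.
have [->|/set0P[x0 Sx0]] := eqVneq S set0; [by left|right].
(* Rejected inputs are sent to a fixed member, so they do not enlarge the range. *)
exists (fun c => if P c then out c else x0).
  by apply: rec_if => //; exact: rec_cst.
apply/seteqP; split => [x /complete[c Pc <-]|_ [c _ <-]]; first by exists c; rewrite ?Pc.
by case: ifP => // /sound.
Qed.

(** * Sets and complexes coded by numbers *)

Lemma bit_lt n i : bit n i -> i < n.
Proof.
rewrite /bit => b; apply: leq_trans (ltn_expl i (isT : 1 < 2)) _.
by rewrite leqNgt; apply/negP => lt; rewrite divn_small in b.
Qed.

Lemma sum_bits m k : k < 2 ^ m -> \sum_(i < m | bit k i) 2 ^ i = k.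
Proof.
elim: m k => [|m IH] k ltk; first by rewrite big_ord0; move: ltk; rewrite ltnS leqn0 => /eqP.
rewrite big_mkcond big_ord_recl -big_mkcond /= {1}/bit divn1.
have bitS i : bit k i.+1 = bit (k %/ 2) i by rewrite /bit expnS divnMA.
have /IH : k %/ 2 < 2 ^ m by rewrite ltn_divLR // -expnSr.
rewrite (eq_bigl (fun i : 'I_m => bit (k %/ 2) i)) => [|i]; last first.
  by rewrite /= /bump leq0n add1n bitS.
rewrite (eq_bigr (fun i : 'I_m => 2 ^ i * 2)) => [|i _]; last first.
  by rewrite /= /bump leq0n add1n expnSr.
rewrite -big_distrl /= => ->; rewrite [RHS](divn_eq k 2) modn2 addnC; congr addn.
Qed.

Definition bits n : {fset nat} := [fset i in iota 0 n | bit n i]%fset.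

Lemma in_bits n i : (i \in bits n) = bit n i.
Proof. 
rewrite !inE /= mem_iota add0n; apply: andb_idl => b.
by rewrite leq0n bit_lt.
Qed.

Lemma bitsK : cancel bits (fset_code id).
Proof.
move=> n; rewrite /fset_code -[RHS](sum_bits (ltn_expl n (isT : 1 < 2))).
rewrite -(big_mkord (bit n) (fun i => 2 ^ i)).
rewrite -[RHS]big_filter.
have bits_perm : perm_eq (bits n) [seq i <- index_iota 0 n | bit n i].
  apply: uniq_perm; rewrite ?fset_uniq ?filter_uniq ?iota_uniq // => i.
  rewrite in_bits mem_filter /index_iota mem_iota subn0 add0n leq0n /=.
  exact/esym/andb_idr/bit_lt.
exact: (perm_big _ bits_perm).
Qed.

Lemma fset_codeK : cancel (fset_code id) bits.
Proof. by move=> A; apply: (fset_code_inj (@inj_id nat)); rewrite bitsK. Qed.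

Lemma bit_fset_code_id (A : {fset nat}) i : bit (fset_code id A) i = (i \in A).
Proof. by rewrite -in_bits fset_codeK. Qed.

Lemma fset_code_sub (A B : {fset nat}) :
  (A `<=` B)%fset -> fset_code id A <= fset_code id B.
Proof.
move=> /fsubsetP AB; set a := fset_code id A; set b := fset_code id B.
have lt x : x <= a + b -> x < 2 ^ (a + b).
  by move=> xab; apply: leq_ltn_trans xab (ltn_expl _ _).
rewrite -[a](sum_bits (lt a (leq_addr _ _))) -[b in leqRHS](sum_bits (lt b (leq_addl _ _))).
rewrite big_mkcond [leqRHS]big_mkcond; apply: leq_sum => i _.
by rewrite !bit_fset_code_id; case: ifP => // /AB ->.
Qed.

Lemma fset_code_imfset (T : choiceType) (c : T -> nat) (A : {fset T}) :
  injective c -> fset_code c A = fset_code id (c @` A)%fset.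
Proof. by move=> c_inj; rewrite /fset_code big_imfset //= => x y _ _; apply: c_inj. Qed.

Lemma bit_fset_code (T : choiceType) (c : T -> nat) (A : {fset T}) i :
  injective c -> reflect (exists2 x, x \in A & i = c x) (bit (fset_code c A) i).
Proof.
move=> c_inj; rewrite fset_code_imfset // bit_fset_code_id.
exact: (iffP (imfsetP _ _ _ _)).
Qed.

Lemma fset_code_surj (T : choiceType) (c : T -> nat) n :
  injective c -> (forall i, bit n i -> exists x, c x = i) ->
  exists A : {fset T}, fset_code c A = n.
Proof.
move=> c_inj surj.
have /choice[dec decP] : forall i : bits n, exists x, c x = val i.
  by move=> -[i ibits]; apply: surj; rewrite -in_bits.
exists [fset dec i | i : bits n]%fset; rewrite fset_code_imfset // -[RHS]bitsK.
congr fset_code; apply/fsetP => i; apply/imfsetP/idP => [[x /imfsetP[j _ ->] ->]|ibits].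
  by rewrite decP; exact: valP.
by exists (dec [` ibits]%fset); rewrite ?decP // in_imfset.
Qed.

Section Vertices.
Variable K : complex.
Let k := complex_code K.

Lemma bit_complex s : reflect (exists2 F, F \in faces K & s = fset_code id F) (bit k s).
Proof. exact/bit_fset_code/fset_code_inj/inj_id. Qed.

Lemma bit_complex_bits s : bit k s = (bits s \in faces K).
Proof.
apply/bit_complex/idP => [[F FK ->]|sK]; first by rewrite fset_codeK.
by exists (bits s); rewrite ?bitsK.
Qed.

Lemma in_vertices v : reflect (exists2 F, F \in faces K & v \in F) (v \in vertices K).
Proof.
apply: (iffP (bigfcupP _ _ _ _)) => [[F]|[F FK vF]]; first by rewrite andbT => FK vF; exists F.
by exists F; rewrite ?andbT.
Qed.

Lemma vertices_lt v : v \in vertices K -> v < k.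
Proof.
move=> /in_vertices[F FK vF]; apply: (@ltn_trans (fset_code id F)).
  by apply: bit_lt; rewrite bit_fset_code_id.
by apply: bit_lt; apply/bit_complex; exists F.
Qed.

Lemma complex_code_gt0 : 0 < k.
Proof.
have /fset0Pn[F FK] := faces_neq0 K.
by apply: leq_ltn_trans (leq0n (fset_code id F)) _; apply: bit_lt; apply/bit_complex; exists F.
Qed.

End Vertices.

Lemma check_complex_code (K : complex) : check_complex (complex_code K).
Proof.
apply/and3P; split; first exact: complex_code_gt0.
  rewrite bit_complex_bits (_ : bits 0 = fset0) ?fset0_faces //.
  by apply/fsetP => i; rewrite in_bits /bit div0n.
apply/forall_ltP => s _; apply/implyP; rewrite bit_complex_bits => sK.
apply/forall_ltP => s' s'k; apply/implyP => /andP[s'0 /forall_ltP sub].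
rewrite bit_complex_bits.
apply: faces_closed sK _ _.
  apply/fsubsetP => v; rewrite !in_bits => vs'; exact: (implyP (sub v (ltn_trans (bit_lt vs') s'k))).
by apply: contraL s'0 => /eqP s'0; rewrite -[s']bitsK s'0 /fset_code big_seq_fset0.
Qed.

Lemma complex_code_check k : check_complex k -> exists K, complex_code K = k.
Proof.
case/and3P => k0 k00 /forall_ltP closed.
have [A codeA] : exists A : {fset {fset nat}}, fset_code (fset_code id) A = k.
  apply: fset_code_surj; first exact/fset_code_inj/inj_id.
  by move=> i _; exists (bits i); rewrite bitsK.
have inA F : (F \in A) = bit k (fset_code id F).
  rewrite -codeA; have bitA := bit_fset_code A (fset_code id F) (fset_code_inj (@inj_id nat)).
  apply/idP/bitA => [FA|[G GA /(fset_code_inj (@inj_id nat)) -> //]].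
  by exists F.
have A0 : A != fset0.
  by apply: contraTneq k0 => A0; rewrite -codeA A0 /fset_code big_seq_fset0.
have fset0A : fset0 \notin A by rewrite inA /fset_code big_seq_fset0.
have Aclosed (s t : {fset nat}) : s \in A -> (t `<=` s)%fset -> t != fset0 -> t \in A.
  rewrite !inA => ks /fsubsetP ts t0.
  have tk : fset_code id t < k.
    by rewrite (leq_ltn_trans _ (bit_lt ks)) ?fset_code_sub //; apply/fsubsetP.
  have /forall_ltP/(_ _ tk)/implyP := implyP (closed _ (bit_lt ks)) ks; apply.
  apply/andP; split.
    rewrite lt0n; apply: contra t0 => /eqP t0; rewrite -[t]fset_codeK t0.
    by apply/eqP/fsetP => i; rewrite in_bits /bit div0n.
  apply/forall_ltP => v _; rewrite !bit_fset_code_id; apply/implyP; exact: ts.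
by exists (Complex A0 fset0A Aclosed).
Qed.

Local Open Scope classical_set_scope.
Local Open Scope ring_scope.

(** * Barycentric coordinates *)

Section Coordinates.
Variables (R : realType) (K : complex).
Let k := complex_code K.
Implicit Types b c : realization R K.

(** Extending by 0 lets coordinates be indexed by all numbers below [k], as in the codes of grid
    points, instead of by the vertices. *)
Definition bary b (v : nat) : R := oapp b 0 (insub v).

Lemma bary_val b (u : vertices K) : bary b (val u) = b u.
Proof. by rewrite /bary valK. Qed.

Lemma bary_out b v : v \notin vertices K -> bary b v = 0.
Proof. by move=> nv; rewrite /bary insubN. Qed.

Lemma sum_vertices (F : nat -> R) : (forall v, v \notin vertices K -> F v = 0) ->
  \sum_(v < k) F v = \sum_(u : vertices K) F (val u).
Proof.
move=> F0; rewrite -(big_seq_fsetE _ _ xpredT).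
rewrite -(big_mkord xpredT F) (bigID (mem (vertices K))) /= [X in _ + X]big1 ?addr0 => [|v]; last exact: F0.
rewrite -big_filter; apply: perm_big; apply: uniq_perm; rewrite ?filter_uniq ?iota_uniq ?fset_uniq // => v.
rewrite mem_filter /index_iota mem_iota subn0 add0n leq0n /=.
exact/andb_idr/vertices_lt.
Qed.

Lemma bary_ge0 b v : 0 <= bary b v.
Proof.
rewrite /bary; case: insubP => //= u _ _.
by case: b => b /= /and3P[/forallP/(_ u)/andP[]].
Qed.

Lemma sum_bary b : \sum_(v < k) bary b v = 1.
Proof.
rewrite sum_vertices => [|v]; last exact: bary_out.
under eq_bigr do rewrite bary_val.
by case: b => b /= /and3P[_ /eqP].
Qed.

Lemma bary_le1 b v : bary b v <= 1.
Proof.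
rewrite /bary; case: insubP => //= u _ _.
by case: b => b /= /and3P[/forallP/(_ u)/andP[]].
Qed.

Lemma bary_support b : exists2 s, bit k s & forall v, bit s v = (0 < bary b v).
Proof.
exists (fset_code id [fset val v | v : vertices K & 0 < b v]%fset).
  rewrite bit_complex_bits fset_codeK.
  by case: b => b /= /and3P[_ _].
move=> v; rewrite bit_fset_code_id.
apply/imfsetP/idP => [[u /= u0 ->]|]; first by rewrite bary_val; rewrite inE in u0.
rewrite /bary; case: insubP => [u _ <-|_] /=; last by rewrite ltxx.
by move=> u0; exists u => //; rewrite inE.
Qed.

Lemma realization_ex (x : nat -> R) s : bit k s -> (forall v, 0 <= x v) ->
  \sum_(v < k) x v = 1 -> (forall v, (v < k)%N -> 0 < x v -> bit s v) ->
  exists b, forall v, (v < k)%N -> bary b v = x v.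
Proof.
move=> ks x0 x1 xs.
have xout v : (v < k)%N -> v \notin vertices K -> x v = 0.
  move=> vk; apply: contraNeq => xv.
  have {}xv : 0 < x v by rewrite lt_neqAle eq_sym xv x0.
  apply/in_vertices; exists (bits s); rewrite -?bit_complex_bits // in_bits.
  exact: xs.
pose y v := if (v < k)%N then x v else 0.
have yE : \sum_(u : vertices K) x (val u) = 1.
  rewrite -[RHS]x1 (eq_bigr (fun v : 'I_k => y v)) => [|v _]; last by rewrite /y ltn_ord.
  rewrite sum_vertices => [|v nv]; last by rewrite /y; case: ifP => // /xout ->.
  by apply: eq_bigr => u _; rewrite /y vertices_lt //; exact: valP.
have inK : in_realization [ffun u : vertices K => x (val u)].
  apply/and3P; split.
  - apply/forallP => u; rewrite ffunE x0 /= -yE (bigD1 u) //= lerDl sumr_ge0 //.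
  - by rewrite (eq_bigr (fun u => x (val u))) ?yE // => u _; rewrite ffunE.
  - have [v vk xv] : exists2 v, (v < k)%N & 0 < x v.
      apply: contrapT => nx; move/eqP: x1; rewrite big1 ?(eq_sym 0) ?oner_eq0 // => v _.
      apply/eqP; rewrite eq_le x0 andbT leNgt; apply/negP => xv; apply: nx.
      by exists (nat_of_ord v); [exact: ltn_ord|exact: xv].
    have vK : v \in vertices K by apply: contraLR xv => /(xout _ vk) ->; rewrite ltxx.
    apply: (@faces_closed K (bits s)); rewrite -?bit_complex_bits //.
      apply/fsubsetP => w /imfsetP[u /= u0 ->]; rewrite in_bits.
      apply: xs; first exact/vertices_lt/valP.
      by move: u0; rewrite inE ffunE.
    apply/fset0Pn; exists v; apply/imfsetP; exists [` vK]%fset => //=.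
    by rewrite inE ffunE.
exists (Realization inK) => v vk; have [vK|vK] := boolP (v \in vertices K).
  by rewrite -[v]/(val [` vK]%fset) bary_val /= ffunE.
by rewrite bary_out // xout.
Qed.

Lemma mdist_bary b c :
  mdist b c = Num.sqrt (\sum_(v < k) (bary b v - bary c v) ^+ 2).
Proof.
rewrite (@sum_vertices (fun v => (bary b v - bary c v) ^+ 2)) => [|v nv]; last by rewrite !bary_out // subrr expr0n.
by congr Num.sqrt; apply: eq_bigr => v _; rewrite !bary_val.
Qed.

Lemma bary_le_mdist b c v : `|bary b v - bary c v| <= mdist b c.
Proof.
have [vK|vK] := boolP (v \in vertices K); last first.
  by rewrite !bary_out // subrr normr0 mdist_ge0.
rewrite mdist_bary -sqrtr_sqr ler_wsqrtr // (bigD1 (Ordinal (vertices_lt vK))) //=.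
by rewrite lerDl sumr_ge0 // => w _; exact: sqr_ge0.
Qed.

Lemma mdist_le b c (r : R) : 0 <= r ->
  (forall v, (v < k)%N -> `|bary b v - bary c v| <= r) -> mdist b c <= k%:R * r.
Proof.
move=> r0 H; rewrite mdist_bary -[leRHS]ger0_norm ?mulr_ge0 // -sqrtr_sqr ler_wsqrtr //.
apply: (@le_trans _ _ (\sum_(v < k) r ^+ 2)).
  by apply: ler_sum => v _; rewrite -real_normK ?num_real // ler_pXn2r ?nnegrE // H.
rewrite sumr_const card_ord exprMn -[r ^+ 2 *+ _]mulr_natl ler_wpM2r ?sqr_ge0 //.
by rewrite expr2 ler_peMl // ler1n complex_code_gt0.
Qed.

Lemma bary_continuous v : continuous (bary ^~ v).
Proof.
move=> b A; rewrite -!filter_from_ballE => -[e /= e0 eA]; exists e => //= c.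
rewrite ballEmdist /= => bce; apply: eA; apply: le_lt_trans bce.
exact: bary_le_mdist.
Qed.

Lemma cvg_realization (T : Type) (F : set_system T) (FF : Filter F)
    (f : T -> realization R K) b :
  (forall v, (v < k)%N -> bary (f x) v @[x --> F] --> bary b v) -> f @ F --> b.
Proof.
move=> cf A; rewrite -filter_from_ballE => -[e /= e0 eA].
(* Dividing by [k + 1] instead of [k] makes the final inequality strict. *)
have k1 : 0 < k%:R + 1 :> R by rewrite ltr_pwDr.
have d0 : 0 < e / (k%:R + 1) by rewrite divr_gt0.
have : \forall y \near F, forall v : 'I_k, `|bary b v - bary (f y) v| < e / (k%:R + 1).
  apply: filter_forall => v; have /cvgrPdist_lt/(_ _ d0) := cf v (ltn_ord v).
  exact.
apply: filterS => y H; apply: eA; rewrite ballEmdist /=.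
apply: le_lt_trans (mdist_le (ltW d0) _) _.
  by move=> v vk; exact/ltW/(H (Ordinal vk)).
by rewrite mulrCA gtr_pMr // ltr_pdivrMr // mul1r ltrDl.
Qed.

Lemma continuous_realization (T : topologicalType) (f : T -> realization R K) :
  (forall v, (v < k)%N -> continuous (fun x => bary (f x) v)) -> continuous f.
Proof. by move=> cf x; apply: cvg_realization => v vk; exact: cf. Qed.

End Coordinates.
Arguments bary {R K} b v.

(** * Continuous extension of operations on the grid *)

Lemma continuous_proj_bary (R : realType) (K : complex) n (j : 'I_n) v :
  continuous (fun x : power (realization R K) n => bary (x j) v).
Proof.
move=> x.
have pj : {for x, continuous (fun x : power (realization R K) n => x j)}.
  exact: (@proj_continuous _ (fun _ : 'I_n => realization R K : topologicalType) j).
exact: (continuous_comp pj (@bary_continuous R K v (x j))).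
Qed.

Lemma natr_ltD1 (R : realType) (a b c : nat) :
  a%:R - b%:R < c%:R + 1 :> R -> (a <= b + c)%N.
Proof. by move=> ab; rewrite -ltnS -(ltr_nat R) -natr1 natrD; lra. Qed.

(* The values [f i] at the grid points [G i] are averaged with the weights of *)
(* a partition of unity; the hypothesis [f_simplex] puts the values that are  *)
(* averaged at a given point in a common simplex, where they may be averaged. *)
Section Extension.
Variables (R : realType) (K : complex) (n N c : nat) (I : finType).
Variables (G : I -> 'I_n -> nat -> nat) (f : I -> nat -> nat).
Let k := complex_code K.
Hypothesis N0 : (0 < N)%N.
Hypothesis cover : forall x : power (realization R K) n, exists i, forall j v,
  (v < k)%N -> `|N%:R * bary (x j) v - (G i j v)%:R| <= c%:R.
Hypothesis f_sum : forall i, (\sum_(v < k) f i v = N)%N.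
Hypothesis f_simplex : forall i, exists2 s, bit k s & forall i',
  (forall j v, (v < k)%N -> (G i j v <= G i' j v + (2 * c + 1))%N &&
    (G i' j v <= G i j v + (2 * c + 1))%N) ->
  forall v, (v < k)%N -> (0 < f i' v)%N -> bit s v.

(** The tents reach to distance [c.+1], beyond the covering radius [c], so some weight is positive
    at every point and the total can be divided by. *)
Let tent (x : power (realization R K) n) i (j : 'I_n) (v : nat) : R :=
  Num.max 0 (c.+1%:R - `|N%:R * bary (x j) v - (G i j v)%:R|).
Let weight i x : R := \prod_(j < n) \prod_(v < k) tent x i j v.
Let total x : R := \sum_i weight i x.
Let value v x : R := (\sum_i weight i x * (f i v)%:R) / (N%:R * total x).

Let tent_ge0 x i j v : 0 <= tent x i j v.
Proof. by rewrite /tent le_max lexx. Qed.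

Let weight_ge0 i x : 0 <= weight i x.
Proof. by apply: prodr_ge0 => j _; apply: prodr_ge0 => v _. Qed.

Let weight_near i x : weight i x != 0 -> forall j v, (v < k)%N ->
  `|N%:R * bary (x j) v - (G i j v)%:R| < c.+1%:R.
Proof.
move=> /prodf_neq0 w j v vk; have /prodf_neq0/(_ (Ordinal vk) isT) := w j isT.
by apply: contraNT; rewrite -leNgt -subr_le0 /tent => /max_l ->.
Qed.

Let total_gt0 x : 0 < total x.
Proof.
have [i xi] := cover x; rewrite /total (bigD1 i) //= ltr_wpDr ?sumr_ge0 //.
apply: prodr_gt0 => j _; apply: prodr_gt0 => v _; rewrite /tent lt_max subr_gt0.
by apply/orP; right; apply: le_lt_trans (xi j v (ltn_ord v)) _; rewrite ltr_nat.
Qed.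

Let tent_continuous i j v : continuous (fun x => tent x i j v).
Proof.
move=> x; apply: (@continuous_max R (power (realization R K) n) (cst 0)
  (fun x : power (realization R K) n => c.+1%:R - `|N%:R * bary (x j) v - (G i j v)%:R|)); first exact: cst_continuous.
apply: continuousB; first exact: cst_continuous.
apply: continuous_comp; last exact: norm_continuous.
apply: continuousB; last exact: cst_continuous.
apply: continuousM; first exact: cst_continuous.
exact: continuous_proj_bary.
Qed.

Let weight_continuous i : continuous (weight i).
Proof.
apply: (@continuous_big R^o 'I_n *%R 1 xpredT (@mul_continuous _) (power (realization R K) n)
  _ (fun j x => \prod_(v < k) tent x i j v)) => j _.
apply: (@continuous_big R^o 'I_k *%R 1 xpredT (@mul_continuous _) (power (realization R K) n)
  _ (fun v x => tent x i j v)) => v _.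
exact: tent_continuous.
Qed.

Let value_continuous v : continuous (value v).
Proof.
have sum_continuous (H : I -> power (realization R K) n -> R) :
    (forall i, continuous (H i)) -> continuous (fun x => \sum_i H i x).
    by move=> cH; apply: (@continuous_big R^o I +%R 0 xpredT (@add_continuous R^o) (power (realization R K) n) (index_enum I) H).
move=> x; apply: (@continuousM _ _ (fun x => \sum_i weight i x * (f i v)%:R)
    (fun x => (N%:R * total x)^-1)).
  apply: (sum_continuous (fun i x => weight i x * (f i v)%:R)) => i {}x.
  by apply: continuousM; [exact: weight_continuous|exact: cst_continuous].
apply: continuousV; first by rewrite mulf_neq0 ?gt_eqF // ltr0n.
apply: (@continuousM _ _ (cst N%:R) total); first exact: cst_continuous.
exact/sum_continuous/weight_continuous.
Qed.

(** An average of numbers within [m] of [y] is within [m] of [y]. Leaving [y] and [m] free transfers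
    every bound visible on the nearby table entries to the extension. *)
Lemma extension_ex : exists F : power (realization R K) n -> realization R K,
  continuous F /\ forall x v y m, (v < k)%N ->
    (forall i, (forall j w, (w < k)%N -> `|N%:R * bary (x j) w - (G i j w)%:R| < c.+1%:R) ->
      `|(f i v)%:R - y| <= m) ->
    `|N%:R * bary (F x) v - y| <= m.
Proof.
have NR : 0 < N%:R :> R by rewrite ltr0n.
have /choice[F FE] : forall x, exists b : realization R K, forall v, (v < k)%N -> bary b v = value v x.
  move=> x; have [i xi] := cover x; have [s ks simplex] := f_simplex i.
  apply: (realization_ex ks) => [v||v vk].
  - apply: divr_ge0; last by rewrite mulr_ge0 // ltW.
    by apply: sumr_ge0 => i' _; rewrite mulr_ge0.
  - rewrite -mulr_suml exchange_big /=.
    under eq_bigr => i' _ do rewrite -mulr_sumr -natr_sum f_sum.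
    by rewrite -mulr_suml -/(total x) [total x * _]mulrC mulfV // mulf_neq0 ?gt_eqF.
  (* A positive average has a positive entry of nonzero weight, and the tuple of that entry is near
     the covering tuple [i], whose face [s] was chosen. *)
  - move=> v0; have [i' wi' fi'] : exists2 i', weight i' x != 0 & (0 < f i' v)%N.
      apply: contrapT => nx; move: v0; rewrite /value big1 ?mul0r ?ltxx // => i' _.
      have [->|wi'] := eqVneq (weight i' x) 0; first by rewrite mul0r.
      have [->|fi'] := posnP (f i' v); first by rewrite mulr0.
      by case: nx; exists i'.
    apply: (simplex i') fi' => // j w wk.
    have {wi'}lt1 := weight_near wi' j wk; have le2 := xi j w wk.
    move: lt1 le2; rewrite ltr_norml ler_norml -natr1 => /andP[? ?] /andP[? ?].
    by apply/andP; split; apply: (@natr_ltD1 R); rewrite natrD natrM; lra.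
exists F; split.
  apply: continuous_realization => v vk.
  have -> : (fun x => bary (F x) v) = value v by apply/funext => x; rewrite FE.
  exact: value_continuous.
move=> x v y m vk near_m; rewrite FE //.
have -> : N%:R * value v x - y = (\sum_i weight i x * ((f i v)%:R - y)) / total x.
  under [in RHS]eq_bigr do rewrite mulrBr.
  rewrite sumrB -mulr_suml -/(total x) /value; field.
  by rewrite !gt_eqF.
rewrite normrM normfV (gtr0_norm (total_gt0 x)) ler_pdivrMr // mulr_sumr.
apply: le_trans (ler_norm_sum _ _ _) _; apply: ler_sum => i _.
rewrite normrM ger0_norm // mulrC; have [->|wi] := eqVneq (weight i x) 0; first by rewrite !mulr0.
rewrite ler_wpM2r // near_m // => j w wk.
exact: weight_near.
Qed.

End Extension.

(** * Rounding to grid points *)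

Lemma code_mkseq (g : nat -> nat) n B : (forall j, (j < n)%N -> (g j <= B)%N) ->
  exists2 h, (h < code_bound B n)%N & forall j, (j < n)%N -> code_nth h j = g j.
Proof.
move=> gB; exists (CodeSeq.code (mkseq g n)).
  rewrite -[n in code_bound _ n](size_mkseq g n); apply: code_lt_bound => a.
  by move=> /mapP[j]; rewrite mem_iota => jn ->; apply: gB.
by move=> j jn; rewrite code_nth_code nth_mkseq.
Qed.

(** Rounding is always downwards, so the rounded coordinates of a point never exceed the available
    mass [N]. *)
Lemma round_coordinate (R : realType) (N : nat) (b e : R) : 0 <= b -> 0 <= e ->
  exists2 h : nat, 0 <= N%:R * b - h%:R <= N%:R * e + 1 & ((0 < h)%N -> e < b).
Proof.
move=> b0 e0; have N0 : 0 <= N%:R :> R by [].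
have [be|be] := leP b e.
  exists 0 => //; rewrite subr0 mulr_ge0 //=.
  by apply: (@le_trans _ _ (N%:R * e)); [rewrite ler_wpM2l|rewrite lerDl].
have x0 : 0 <= N%:R * (b - e) by rewrite mulr_ge0 // subr_ge0 ltW.
exists (Num.truncn (N%:R * (b - e))) => //.
have /andP[] := truncn_itv x0; rewrite -natr1 mulrBr.
have := mulr_ge0 N0 e0; set x := N%:R * b; set y := N%:R * e; set z := _%:R.
by move=> ? ? ?; apply/andP; split; lra.
Qed.

(* Coordinates are cut off at [e] before rounding, so that all the points     *)
(* within [e] of a given point are rounded into a common simplex; the lost    *)
(* mass goes to a vertex where [b] exceeds [e].                               *)
Lemma round_ex (R : realType) (K : complex) (b : realization R K) (N : nat) (e : R) :
  0 <= e -> (complex_code K)%:R * e < 1 ->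
  exists x, [/\ is_point (complex_code K) N x,
    forall v, (v < complex_code K)%N -> `|N%:R * bary b v - (code_nth x v)%:R| <=
      (complex_code K)%:R * (N%:R * e + 1) &
    forall v, (v < complex_code K)%N -> (0 < code_nth x v)%N -> e < bary b v].
Proof.
move=> e0; set k := complex_code K => ke.
have NR : 0 <= N%:R :> R by [].
(* Otherwise the coordinates, of sum 1, would add up to at most [k * e < 1]. *)
have [w bw] : exists w : 'I_k, e < bary b w.
  apply: contrapT => nw; move: ke; rewrite ltNge => /negP; apply; rewrite -[leLHS](sum_bary b) -/k.
  have -> : k%:R * e = \sum_(v < k) e by rewrite sumr_const card_ord mulr_natl.
  apply: ler_sum => v _.
  by rewrite leNgt; apply/negP => bv; apply: nw; exists v.
have /choice[h hP] : forall v, exists h : nat,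
    0 <= N%:R * bary b v - h%:R <= N%:R * e + 1 /\ ((0 < h)%N -> e < bary b v).
  by move=> v; have [h ? ?] := round_coordinate N (bary_ge0 b v) e0; exists h.
have bE : N%:R = N%:R * bary b w + \sum_(v < k | v != w) N%:R * bary b v.
  by have := sum_bary b; rewrite (bigD1 w) //= -mulr_sumr -mulrDr => ->; rewrite mulr1.
have hle : (\sum_(v < k | v != w) h v <= N)%N.
  rewrite -(ler_nat R) natr_sum bE -[leLHS]add0r; apply: lerD.
    by rewrite mulr_ge0 // bary_ge0.
  by apply: ler_sum => v _; rewrite -subr_ge0; have [/andP[]] := hP v.
pose g v := if v == w :> nat then (N - \sum_(u < k | u != w) h u)%N else h v.
have gw : g w = (N - \sum_(u < k | u != w) h u)%N by rewrite /g eqxx.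
have gv (v : 'I_k) : v != w -> g v = h v by rewrite /g -val_eqE => /negPf ->.
have g_sum : (\sum_(v < k) g v = N)%N.
  by rewrite (bigD1 w) //= gw (eq_bigr (fun v : 'I_k => h v)) ?subnK // => v; exact: gv.
have gN v : (v < k)%N -> (g v <= N)%N.
  by move=> vk; rewrite -g_sum (bigD1 (Ordinal vk)) //= leq_addr.
have [x xlt xE] := code_mkseq gN.
have gb v : (v < k)%N -> (0 < g v)%N -> e < bary b v.
  rewrite /g; case: eqP => [-> //|_] _; exact: (hP v).2.
exists x; split => // [|v vk|v vk]; last by rewrite xE //; exact: gb.
  apply/and3P; split => //.
    by rewrite /sum_lt (eq_bigr (fun v : 'I_k => g v)) ?g_sum // => v _; rewrite xE.
  have [s ks bs] := bary_support b; apply/exists_ltP; exists s; first exact: bit_lt.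
  rewrite ks /=; apply/forall_ltP => v vk; apply/implyP; rewrite xE // bs => gv0.
  exact: le_lt_trans (gb v vk gv0).
rewrite xE //; have k1 : 1 <= k%:R :> R by rewrite ler1n complex_code_gt0.
have c0 : 0 <= N%:R * e + 1 by rewrite addr_ge0 ?mulr_ge0.
rewrite /g; case: eqP => [->|_]; last first.
  have [/andP[b0 b1] _] := hP v.
  by rewrite ger0_norm // (le_trans b1) // ler_peMl.
(* Both coordinate families have sum [N], so the error at [w] is the opposite of the sum of the
   other errors; this is why the bound carries the factor [k]. *)
have -> : N%:R * bary b w - (N - \sum_(u < k | u != w) h u)%:R =
    - \sum_(v < k | v != w) (N%:R * bary b v - (h v)%:R).
  rewrite natrB // natr_sum sumrB {2}bE; ring.
rewrite normrN ger0_norm; last by apply: sumr_ge0 => u _; have [/andP[]] := hP u.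
have -> : k%:R * (N%:R * e + 1) = \sum_(u < k) (N%:R * e + 1).
  by rewrite sumr_const card_ord mulr_natl.
rewrite [leRHS](bigD1 w) //= -[leLHS]add0r; apply: lerD => //; apply: ler_sum => u _.
by have [/andP[]] := hP u.
Qed.

(** * Soundness of certificates *)

Lemma nth_enum_ord n (F : 'I_n -> nat) (j : 'I_n) :
  nth 0%N [seq F i | i <- enum 'I_n] j = F j.
Proof. by rewrite (nth_map j) ?size_enum_ord // nth_ord_enum. Qed.

Lemma equation_code_inj ar : injective (@equation_code ar).
Proof.
by move=> [s t] [s' t'] /(can_inj CodeSeq.codeK)[] /term_code_inj -> /term_code_inj ->.
Qed.

Lemma ltn_code_mem s j : j \in s -> (j < CodeSeq.code s)%N.
Proof. by move=> js; apply: (allP (CodeSeq.ltn_code s)). Qed.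

Lemma subterm_code_lt ar i (ts : (term ar) ^ (ar i)) j :
  (term_code (ts j) < term_code (App ts))%N.
Proof.
by apply: ltn_code_mem; rewrite inE; apply/orP; right; apply: map_f; rewrite mem_enum.
Qed.

Lemma symbol_lt ar i (ts : (term ar) ^ (ar i)) : (i < term_code (App ts))%N.
Proof. by apply: (@ltn_trans i.+1) => //; apply: ltn_code_mem; rewrite inE eqxx. Qed.

Lemma variable_lt ar x : (x < term_code (Var ar x))%N.
Proof. by apply: ltn_code_mem; rewrite !inE eqxx orbT. Qed.

Lemma code_cons_inj a a' s s' : code_cons a s = code_cons a' s' -> a = a' /\ s = s'.
Proof.
move=> e; split; first by rewrite -(logn_code_cons a s) e logn_code_cons.
by rewrite -(code_tail_cons a s) e code_tail_cons.
Qed.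

Lemma realization_inhabited (R : realType) (K : complex) : inhabited (realization R K).
Proof.
have /fset0Pn[F FK] := faces_neq0 K.
have /fset0Pn[w wF] : F != fset0 by apply: contraTneq FK => ->; exact: fset0_faces.
have wk : (w < complex_code K)%N by apply/vertices_lt/in_vertices; exists F.
have [||||b _] := @realization_ex R K (fun v => (v == w)%:R) (fset_code id F).
- by rewrite bit_complex_bits fset_codeK.
- by move=> v; rewrite ler0n.
- by rewrite (bigD1 (Ordinal wk)) //= eqxx big1 ?addr0 // => v; rewrite -val_eqE => /negPf /= ->.
- move=> v _; rewrite bit_fset_code_id.
  by case: eqP => [->|]; rewrite ?ltxx.
- exact: inhabits b.
Qed.

Definition approx (R : realType) (K : complex) (N : nat) (d : R) (b : realization R K) x :=
  forall v, (v < complex_code K)%N -> `|N%:R * bary b v - (code_nth x v)%:R| <= d.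

Lemma code_exists_tuple (k N n : nat) (P : nat -> nat -> Prop) :
  (forall j, (j < n)%N -> exists2 x, is_point k N x & P j x) ->
  exists h, [/\ (h < tuple_bound k N n)%N, is_tuple k N n h &
    forall j, (j < n)%N -> P j (code_nth h j)].
Proof.
move=> H.
have /choice[g gP] : forall j, exists x, (j < n)%N ->
    is_point k N x /\ P j x.
  move=> j; have [/H[x ? ?]|] := boolP (j < n)%N; first by exists x.
  by exists 0%N.
have [h hlt hE] : exists2 h, (h < tuple_bound k N n)%N &
    forall j, (j < n)%N -> code_nth h j = g j.
  by apply: code_mkseq => j /gP[/and3P[/ltnW]].
exists h; split => //; last by move=> j jn; rewrite hE //; have [] := gP j jn.
by apply/forall_ltP => j jn; rewrite hE //; have [] := gP j jn.
Qed.

Lemma round_tuple_ex (R : realType) (K : complex) (a : nat -> realization R K) N n :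
  exists h, [/\ (h < tuple_bound (complex_code K) N n)%N, is_tuple (complex_code K) N n h &
    forall j, (j < n)%N -> approx N (complex_code K)%:R (a j) (code_nth h j)].
Proof.
apply: (@code_exists_tuple _ N n (fun j x => approx N (complex_code K)%:R (a j) x)) => j _.
(* With cut-off 0 the rounding error is [k] units: the origin of the [k] in the radii of the checks
   and in the condition on [M_0]. *)
have [|x [? xa _]] := @round_ex R K (a j) N 0 (lexx 0); first by rewrite mulr0 ltr01.
exists x => // v vk.
by have := xa v vk; rewrite mulr0 add0r mulr1.
Qed.

Lemma tuples_nearC k n d h h' : tuples_near k n d h h' = tuples_near k n d h' h.
Proof.
by rewrite /tuples_near; apply: eq_all => j; apply: eq_all => v; rewrite andbC.
Qed.

Section Operation.
Variables (R : realType) (K : complex) (N n f : nat).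
Let k := complex_code K.
Hypothesis N0 : (0 < N)%N.
Hypothesis simplexP : check_simplex k N n f.

Lemma operation_ex : exists F : power (realization R K) n -> realization R K,
  continuous F /\ forall (x : power (realization R K) n) h m d, (h < tuple_bound k N n)%N -> is_tuple k N n h ->
    (forall j, approx N d%:R (x j) (code_nth h j)) ->
    check_modulus k N n f d m -> approx N m%:R (F x) (code_nth f h).
Proof.
pose T := {h : 'I_(tuple_bound k N n) | is_tuple k N n h}.
pose G (h : T) (j : 'I_n) v := code_nth (code_nth (val (val h)) j) v.
pose g (h : T) v := code_nth (code_nth f (val (val h))) v.
have tupP h (hlt : (h < tuple_bound k N n)%N) (ht : is_tuple k N n h) :
    exists h' : T, val (val h') = h.
  by exists (exist _ (Ordinal hlt) ht).
have cover (x : power (realization R K) n) : exists h : T, forall j v,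
    (v < k)%N -> `|N%:R * bary (x j) v - (G h j v)%:R| <= k%:R.
  have [b] := realization_inhabited R K.
  (* The finite tuple is padded to an assignment of all variables. *)
  pose a j := oapp x b (insub j).
  have [h [hlt ht ha]] := round_tuple_ex a N n; have [h' h'E] := tupP h hlt ht.
  exists h' => j v vk; rewrite /G h'E.
  by have := ha j (ltn_ord j) v vk; rewrite /a valK.
have g_sum (h : T) : (\sum_(v < k) g h v = N)%N.
  have /forall_ltP/(_ _ (ltn_ord (val h)))/implyP/(_ (valP h))/andP[/and3P[_ /eqP + _] _] := simplexP.
  exact.
have g_simplex (h : T) : exists2 s, bit k s & forall h' : T,
    (forall j v, (v < k)%N -> (G h j v <= G h' j v + (2 * k + 1))%N &&
      (G h' j v <= G h j v + (2 * k + 1))%N) ->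
    forall v, (v < k)%N -> (0 < g h' v)%N -> bit s v.
  have /forall_ltP/(_ _ (ltn_ord (val h)))/implyP/(_ (valP h))/andP[_] := simplexP.
  move=> /exists_ltP[s _ /andP[ks /forall_ltP supp]]; exists s => // h' near v vk.
  have /forall_ltP/(_ v vk)/implyP : supp_in k (code_nth f (val (val h'))) s; last exact.
  apply: (implyP (supp _ (ltn_ord (val h')))); apply/andP; split; first exact: (valP h').
  apply/forall_ltP => j jn; apply/forall_ltP => w wk.
  exact: (near (Ordinal jn) w wk).
have [F [Fc FP]] := extension_ex N0 cover g_sum g_simplex.
exists F; split => // x h m d hlt ht xh /forall_ltP modulus v vk.
apply: FP => // h' xh'; rewrite -/(g h' v).
have near : tuples_near k n (d + k + 1) h (val (val h')).
  apply/forall_ltP => j jn; apply/forall_ltP => w wk.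
  have := xh (Ordinal jn) w wk; have := xh' (Ordinal jn) w wk.
  rewrite /G /= ltr_norml ler_norml -natr1 => /andP[? ?] /andP[? ?].
  by apply/andP; split; apply: (@natr_ltD1 R); rewrite !natrD; lra.
have bound := ltn_ord (val h').
have /forall_ltP/(_ _ bound)/implyP := modulus _ hlt.
rewrite ht (valP h') near => /(_ isT)/forall_ltP/(_ _ vk).
have /forall_ltP/(_ _ hlt)/implyP := modulus _ bound.
rewrite ht (valP h') tuples_nearC near => /(_ isT)/forall_ltP/(_ _ vk).
rewrite -!(ler_nat R) !natrD ler_norml => ? ?; apply/andP; split; lra.
Qed.

End Operation.

Lemma term_code_Var ar x : term_code (Var ar x) = code_cons 0 (code_cons x 0).
Proof. exact: etrans (code_consE _ _) (congr1 _ (code_consE _ _)). Qed.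

Lemma term_code_App ar i (ts : (term ar) ^ (ar i)) : term_code (App ts) =
  code_cons i.+1 (CodeSeq.code [seq term_code (ts j) | j <- enum 'I_(ar i)]).
Proof. exact: code_consE. Qed.

Lemma equation_codeE ar (e : equation ar) :
  equation_code e = code_cons (term_code e.1) (code_cons (term_code e.2) 0).
Proof. exact: etrans (code_consE _ _) (congr1 _ (code_consE _ _)). Qed.

Lemma natr_dist (R : realType) (x y : nat) :
  (x - y)%:R + (y - x)%:R = `|x%:R - y%:R| :> R.
Proof.
have [xy|/ltnW xy] := leqP x y; rewrite (eqP xy) natrB //.
  by rewrite add0r distrC ger0_norm // subr_ge0 ler_nat.
by rewrite addr0 ger0_norm // subr_ge0 ler_nat.
Qed.

Lemma distance_le (R : realType) (N s t x y m1 m2 m : R) :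
  `|N * s - x| <= m1 -> `|N * t - y| <= m2 -> m1 <= m -> m2 <= m ->
  (s - t) * N <= `|x - y| + 2 * m.
Proof.
rewrite !ler_norml => /andP[? ?] /andP[? ?] ? ?.
by have := ler_norm (x - y); rewrite mulrC mulrBr; lra.
Qed.

(** Marks are given by the certificate and need not be honest; strong induction on codes shows that
    the checks force a marked number to code a term. *)
Lemma checked_term_ex ar k S N f W E t : check_terms ar k S N f W E ->
  (t < S)%N -> (0 < code_nth W t)%N -> exists tm : term ar, term_code tm = t.
Proof.
move=> /forall_ltP terms; elim/ltn_ind: t => t IH tS Wt.
have /implyP/(_ Wt)/orP[] := terms t tS.
  by move=> /exists_ltP[x _ /andP[/eqP -> _]]; exists (Var ar x); rewrite term_code_Var.
move=> /exists_ltP[i _ /exists_ltP[s st /and4P[/eqP tE /code_tuple sE /forall_ltP Ws _]]].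
have lt j : (j < ar i)%N -> (code_nth s j < t)%N.
  move=> ji; apply: ltn_trans st; rewrite {2}sE; apply: ltn_code_mem.
  by apply: map_f; rewrite mem_iota.
have /choice[ts tsE] : forall j : 'I_(ar i), exists tm : term ar, term_code tm = code_nth s j.
  by move=> j; apply: IH; [exact: lt|exact/(ltn_trans _ tS)/lt|exact: Ws].
exists (App [ffun j => ts j]); rewrite tE sE -code_consE /=; congr (CodeSeq.code (_ :: _)).
rewrite /mkseq -val_enum_ord -map_comp; apply: eq_map => j.
by rewrite ffunE tsE.
Qed.

Section Soundness.
Variables (R : realType) (ar : nat -> nat) (K : complex) (Sigma : {fset equation ar}).
Variables (N f W E M r : nat).
Let k := complex_code K.
Let S := fset_code (@equation_code ar) Sigma.
Let A := realization R K.
Hypothesis N0 : (0 < N)%N.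
Hypothesis opsP : check_operations ar k S N f M.
Hypothesis termsP : check_terms ar k S N f W E.
Hypothesis eqnsP : check_equations k S N W E (code_nth M S) r.

Let M0 : (k <= code_nth M 0)%N.
Proof. by have /and3P[] := opsP. Qed.

Let M_mono s t : (s <= t)%N -> (t <= S)%N -> (code_nth M s <= code_nth M t)%N.
Proof.
have /and3P[_ /forall_ltP mono _] := opsP.
elim: t => [|t IH]; first by rewrite leqn0 => /eqP ->.
rewrite leq_eqVlt ltnS => /orP[/eqP -> //|st tS].
exact: leq_trans (IH st (ltnW tS)) (mono t tS).
Qed.

Let operations_ex : exists F : operations ar A, (forall i, continuous (F i)) /\
  forall i (x : power A (ar i)) h m d, (i < S)%N -> (h < tuple_bound k N (ar i))%N -> is_tuple k N (ar i) h ->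
    (forall j, approx N d%:R (x j) (code_nth h j)) ->
    check_modulus k N (ar i) (code_nth f i) d m ->
    approx N m%:R (F i x) (code_nth (code_nth f i) h).
Proof.
have H i : exists F : power A (ar i) -> A, continuous F /\ ((i < S)%N ->
  forall (x : power A (ar i)) h m d, (h < tuple_bound k N (ar i))%N -> is_tuple k N (ar i) h ->
    (forall j, approx N d%:R (x j) (code_nth h j)) ->
    check_modulus k N (ar i) (code_nth f i) d m ->
    approx N m%:R (F x) (code_nth (code_nth f i) h)).
  (* A symbol occurring in [Sigma] is below [S]; all others are interpreted by constants. *)
  have [iS|_] := boolP (i < S)%N; last first.
    by have [b] := realization_inhabited R K; exists (cst b); split => //; exact: cst_continuous.
  have /and3P[_ _ /forall_ltP/(_ i iS)/andP[simplex _]] := opsP.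
  by have [F [Fc FP]] := operation_ex R N0 simplex; exists F; split => // _; exact: FP.
exists (fun i => projT1 (cid (H i))); split => [i|i x h m d iS].
  by have [] := projT2 (cid (H i)).
by have [_ FP] := projT2 (cid (H i)); apply: FP.
Qed.

Lemma soundness : exists2 F : operations ar A, (forall i, continuous (F i)) &
  (lambda_algebra F Sigma <= (r%:R / N%:R)%:E)%E.
Proof.
have [F [Fc FP]] := operations_ex; exists F => //.
have NR : 0 < N%:R :> R by rewrite ltr0n.
(* The induction must also yield that the listed values are grid points, since the property of the
   operations applies only to tuples of such points. *)
have term_approx (tm : term ar) a h : (term_code tm < S)%N -> (0 < code_nth W (term_code tm))%N ->
    (h < tuple_bound k N S)%N -> is_tuple k N S h ->
    (forall j, (j < S)%N -> approx N k%:R (a j) (code_nth h j)) ->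
    is_point k N (code_nth (code_nth E (term_code tm)) h) /\
    approx N (code_nth M (term_code tm))%:R (term_op F tm a)
      (code_nth (code_nth E (term_code tm)) h).
  move=> + + hlt ht ah; elim: tm => [x|i ts IH] tS Wt.
    have /forall_ltP/(_ _ tS)/implyP/(_ Wt)/orP[] := termsP.
      move=> /exists_ltP[y _ /andP[/eqP]]; rewrite term_code_Var.
      move=> /code_cons_inj[_ /code_cons_inj[<- _]] /forall_ltP/(_ _ hlt)/implyP/(_ ht)/eqP.
      rewrite -(term_code_Var ar) => -> /=; have xS := ltn_trans (variable_lt ar x) tS.
      split; first by move/forall_ltP: ht; apply.
      move=> v vk; apply: le_trans (ah _ xS _ vk) _.
      by rewrite ler_nat (leq_trans M0) // M_mono // ltnW.
    move=> /exists_ltP[i _ /exists_ltP[s _ /and4P[/eqP]]].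
    by rewrite term_code_Var => /code_cons_inj[].
  have /forall_ltP/(_ _ tS)/implyP/(_ Wt)/orP[] := termsP.
    move=> /exists_ltP[y _ /andP[/eqP]].
    by rewrite term_code_App => /code_cons_inj[].
  move=> /exists_ltP[i' _ /exists_ltP[s _ /and4P[/eqP]]].
  rewrite term_code_App => /code_cons_inj[[<-] <-] _ {i' s}.
  move=> /forall_ltP Ws /forall_ltP/(_ _ hlt)/implyP/(_ ht)/exists_ltP[u ult].
  rewrite -term_code_App => /andP[/forall_ltP uE /eqP ->].
  have iS := ltn_trans (symbol_lt ts) tS.
  have sE (j : 'I_(ar i)) : code_nth (CodeSeq.code [seq term_code (ts j) | j <- enum 'I_(ar i)]) j
      = term_code (ts j) by rewrite code_nth_code nth_enum_ord.
  have {}IH (j : 'I_(ar i)) : is_point k N (code_nth u j) /\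
      approx N (code_nth M (term_code (ts j)))%:R (term_op F (ts j) a) (code_nth u j).
    have /eqP -> := uE j (ltn_ord j); rewrite sE; apply: IH.
      exact: ltn_trans (subterm_code_lt ts j) tS.
    by have := Ws j (ltn_ord j); rewrite sE.
  have ut : is_tuple k N (ar i) u.
    by apply/forall_ltP => j ji; have [] := IH (Ordinal ji).
  have /and3P[_ _ /forall_ltP/(_ i iS)/andP[/forall_ltP/(_ _ ult)/implyP/(_ ut)/andP[fu _]]] := opsP.
  move=> /forall_ltP modulus; split => //.
  (* With [t] the code of the term, the arguments are known up to [M_(t-1)], and the modulus check
     at index [t - 1] gives [M_t] for the value. *)
  have t0 : (0 < term_code (App ts))%N by exact: leq_ltn_trans (leq0n i) (symbol_lt ts).
  have tS' : ((term_code (App ts)).-1 < S)%N by rewrite prednK // ltnW.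
  have := modulus _ tS'; rewrite prednK // => /(FP i (fun j => term_op F (ts j) a) u _ _ iS ult ut).
  apply => j v vk; apply: le_trans ((IH j).2 v vk) _.
  by rewrite ler_nat M_mono ?(ltnW tS') // -ltnS prednK // subterm_code_lt.
apply: ge_ereal_sup => _ [->|[[s t] [a [eS ->]]]].
  by rewrite lee_fin divr_ge0.
have be : bit S (equation_code (s, t)).
  by apply/bit_fset_code; [exact: equation_code_inj|exists (s, t)].
have /forall_ltP/(_ _ (bit_lt be))/implyP/(_ be) := eqnsP.
move=> /exists_ltP[s' _ /exists_ltP[t' _ /and4P[/eqP]]].
rewrite equation_codeE => /code_cons_inj[<- /code_cons_inj[<- _]] {s' t'} /=.
have sS : (term_code s < S)%N.
  by apply: ltn_trans (bit_lt be); apply: ltn_code_mem; rewrite !inE eqxx.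
have tS : (term_code t < S)%N.
  by apply: ltn_trans (bit_lt be); apply: ltn_code_mem; rewrite !inE eqxx orbT.
move=> Ws Wt; have [h [hlt ht ah]] := round_tuple_ex a N S.
move=> /forall_ltP/(_ h hlt)/implyP/(_ ht).
have [_ sa] := term_approx s a h sS Ws hlt ht ah.
have [_ ta] := term_approx t a h tS Wt hlt ht ah.
set x := code_nth (code_nth E (term_code s)) h in sa *.
set y := code_nth (code_nth E (term_code t)) h in ta *.
rewrite -(ler_nat R) lee_fin mdist_bary => le_r.
rewrite ler_pdivlMr // -[N%:R]ger0_norm // -sqrtr_sqr -sqrtrM; last first.
  by apply: sumr_ge0 => v _; exact: sqr_ge0.
rewrite -[leRHS]ger0_norm // -sqrtr_sqr ler_wsqrtr //.
rewrite -[r%:R ^+ 2]natrX; apply: le_trans le_r.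
rewrite mulr_suml natr_sum; apply: ler_sum => v _.
rewrite -exprMn natrX -[leLHS]real_normK ?num_real // ler_pXn2r ?nnegrE //.
have := sa v (ltn_ord v); have := ta v (ltn_ord v).
have Ms : (code_nth M (term_code s))%:R <= (code_nth M S)%:R :> R by rewrite ler_nat M_mono // ltnW.
have Mt : (code_nth M (term_code t))%:R <= (code_nth M S)%:R :> R by rewrite ler_nat M_mono // ltnW.
rewrite 2!natrD natrM natr_dist => tv sv; rewrite ler_norml; apply/andP; split.
  by rewrite lerNl -mulNr opprB distrC; exact: distance_le tv sv Mt Ms.
exact: distance_le sv tv Ms Mt.
Qed.

End Soundness.

(** * Uniform continuity *)

Lemma ultra_fmap T T' (f : T -> T') (F : set_system T) :
  UltraFilter F -> UltraFilter (f @ F).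
Proof.
move=> FU; split; first exact: fmap_proper_filter.
move=> G GP sub; apply/seteqP; split => // A GA.
have [//|FnA] := in_ultra_setVsetC (f @^-1` A) FU.
have GnA : G (~` A) by apply: sub.
by have [x [Ax]] := filter_ex (filterI GA GnA).
Qed.

Lemma compact_ultra_cvg (T : Type) (X : topologicalType) (F : set_system T) (f : T -> X)
    (A : set X) :
  UltraFilter F -> compact A -> (forall x, A (f x)) -> exists2 p, A p & f @ F --> p.
Proof.
move=> FU; rewrite compact_ultra => cA fA; have FF : ProperFilter F by apply: ultra_proper.
have [|p [Ap fp]] := cA _ (ultra_fmap f FU); last by exists p.
exact: (@nearW _ F _ _ fA).
Qed.

(** Along an ultrafilter each coordinate converges in [[0, 1]], and the limits have sum 1. Finitely
    many positive limits are positive at a common point of the filter, whose support is a face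
    containing that of the limit. *)
Lemma realization_compact (R : realType) (K : complex) : compact [set: realization R K].
Proof.
rewrite compact_ultra => U UU _; set k := complex_code K.
have UF : ProperFilter U by apply: ultra_proper.
have /choice[l lP] : forall v : nat, exists l : R, (bary^~ v : realization R K -> R) @ U --> l.
  move=> v; have [||l _ lv] := @compact_ultra_cvg _ R U (bary^~ v) `[0, 1]%classic UU.
  - exact: segment_compact.
  - by move=> b; rewrite /= in_itv /= bary_ge0 bary_le1.
  - by exists l.
have l0 v : 0 <= l v.
  apply: (cvgr_to_ge (lP v)); apply: nearW => b; exact: bary_ge0.
have l1 : \sum_(v < k) l v = 1.
  have : \sum_(v < k) bary b v @[b --> U] --> \sum_(v < k) l v.
    apply: (@cvg_big R^o 'I_k +%R 0 xpredT (@add_continuous R^o) _ U _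
      (fun v (b : realization R K) => bary b v) l) => v _; exact: lP.
  under eq_cvg do rewrite sum_bary.
  by move=> h; apply: (cvg_unique _ h); [exact: norm_hausdorff|exact: cvg_cst].
have [b lb] : exists b : realization R K, forall v, (v < k)%N -> 0 < l v -> 0 < bary b v.
  have : \forall b \near U, forall v : 'I_k, 0 < l v -> 0 < bary b v.
    apply: filter_forall => v; have [lv|lv] := ltP 0 (l v); last first.
      by apply: nearW => b; rewrite ltNge.
    near=> b => _; near: b; exact: (cvgr_gt (l v) (lP v) 0 lv).
  move=> /filter_ex[b H]; exists b => v vk; exact: (H (Ordinal vk)).
have [s ks sb] := bary_support b.
have [|c cl] := realization_ex ks l0 l1.
  by move=> v vk lv; rewrite sb; exact: lb.
exists c; split => //; apply: (@cvg_realization R K _ U _ id c) => v vk.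
rewrite cl //; exact: lP.
Unshelve. all: by end_near. Qed.

Lemma bary_inj (R : realType) (K : complex) (b c : realization R K) :
  (forall v, (v < complex_code K)%N -> bary b v = bary c v) -> b = c.
Proof.
move=> bc; apply: (@mdist_positivity R); rewrite mdist_bary big1 ?sqrtr0 // => v _.
by rewrite bc // subrr expr0n.
Qed.

Definition unif_continuous_at (R : realType) (K : complex) n
    (F : power (realization R K) n -> realization R K) (d e : R) :=
  forall x y, (forall j v, (v < complex_code K)%N -> `|bary (x j) v - bary (y j) v| <= d) ->
  forall v, (v < complex_code K)%N -> `|bary (F x) v - bary (F y) v| <= e.

(** Pairs violating uniformity at the scales [1 / (i + 1)] converge along an ultrafilter finer than
    the eventual one, which replaces passing to subsequences; the two limits coincide, contradicting
    continuity. *)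
Lemma operation_unif_continuous (R : realType) (K : complex) n
    (F : power (realization R K) n -> realization R K) (e : R) :
  continuous F -> 0 < e -> exists2 d, 0 < d & unif_continuous_at F d e.
Proof.
move=> Fc e0; set k := complex_code K; set X := power (realization R K) n.
apply: contrapT => nd.
have /choice[xy xyP] : forall i : nat, exists xy : X * X,
    (forall j v, (v < k)%N -> `|bary (xy.1 j) v - bary (xy.2 j) v| <= i.+1%:R^-1) /\
    ~ (forall v, (v < k)%N -> `|bary (F xy.1) v - bary (F xy.2) v| <= e).
  move=> i; apply: contrapT => ni; apply: nd; exists i.+1%:R^-1; first by rewrite invr_gt0.
  move=> x y near; apply: contrapT => far; apply: ni.
  by exists (x, y).
have [U [UU sU]] := ultraFilterLemma (@eventually_filter).
have UF : ProperFilter U by apply: ultra_proper.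
have Xcpt : compact [set: X].
  have := @tychonoff _ (fun _ : 'I_n => realization R K : topologicalType)
    (fun=> setT) (fun=> @realization_compact R K).
  by congr (compact _); apply/seteqP; split.
have [|p _ xp] := @compact_ultra_cvg _ _ U (fun i => (xy i).1) _ UU Xcpt; first by [].
have [|q _ yq] := @compact_ultra_cvg _ _ U (fun i => (xy i).2) _ UU Xcpt; first by [].
have cvg_diff (f g : nat -> R) a b : f @ U --> a -> g @ U --> b ->
    (fun i => f i - g i) @ U --> a - b by move=> fa gb; exact: cvgB.
have pq : p = q.
  apply/funext => j; apply: bary_inj => v vk; apply/eqP; rewrite -subr_eq0.
  have pj : bary ((xy i).1 j) v @[i --> U] --> bary (p j) v.
    exact: (continuous_cvg _ (@continuous_proj_bary R K n j v p) xp).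
  have qj : bary ((xy i).2 j) v @[i --> U] --> bary (q j) v.
    exact: (continuous_cvg _ (@continuous_proj_bary R K n j v q) yq).
  have pqj := cvg_norm (cvg_diff _ _ _ _ pj qj).
  rewrite -normr_le0; apply/ler_addgt0Pr => r r0; rewrite add0r.
  apply: (cvgr_to_le (pqj _)); apply: sU; near=> i.
  apply: le_trans ((xyP i).1 j v vk) _; apply/ltW; near: i.
  exact: (near_infty_natSinv_lt (PosNum r0)).
have : \forall i \near U, forall v : 'I_k, `|bary (F (xy i).1) v - bary (F (xy i).2) v| < e.
  apply: filter_forall => v; apply: cvgr0_norm_lt => //.
  have Fx : bary (F (xy i).1) v @[i --> U] --> bary (F p) v.
    apply: (continuous_cvg _ (@bary_continuous R K v (F p))).
    exact: (continuous_cvg _ (Fc p) xp).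
  have Fy : bary (F (xy i).2) v @[i --> U] --> bary (F p) v.
    apply: (continuous_cvg _ (@bary_continuous R K v (F p))).
    by rewrite pq; exact: (continuous_cvg _ (Fc q) yq).
  by rewrite -(subrr (bary (F p) v)); exact: cvg_diff Fx Fy.
by move=> /filter_ex[i H]; case: (xyP i) => _; apply => v vk; exact/ltW/(H (Ordinal vk)).
Unshelve. all: by end_near. Qed.

(** * Completeness of certificates *)

Lemma operations_unif_continuous (R : realType) (K : complex) (ar : nat -> nat)
    (F : operations ar (realization R K)) S (e : R) :
  (forall i, continuous (F i)) -> 0 < e ->
  exists2 d, 0 < d & forall i, (i < S)%N -> unif_continuous_at (F i) d e.
Proof.
move=> Fc e0; elim: S => [|S [d d0 dP]]; first by exists 1.
have [d' d'0 d'P] := operation_unif_continuous (Fc S) e0.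
exists (Num.min d d'); first by rewrite lt_min d0.
move=> i; rewrite ltnS leq_eqVlt => /orP[/eqP ->|iS] x y xy.
  by apply: d'P => j v vk; rewrite (le_trans (xy j v vk)) // ge_min lexx orbT.
by apply: (dP i iS) => j v vk; rewrite (le_trans (xy j v vk)) // ge_min lexx.
Qed.

(* The moduli are chosen backwards, from the accuracy [e] required at [n].    *)
Lemma modulus_chain (R : realType) (UC : R -> R -> Prop) n (e : R) :
  (forall e, 0 < e -> exists2 d, 0 < d & UC d e) ->
  (forall d d' e, d' <= d -> UC d e -> UC d' e) -> 0 < e ->
  exists delta : nat -> R, [/\ delta n <= e, forall t, (t <= n)%N -> 0 < delta t &
    forall t, (t < n)%N -> delta t <= delta t.+1 /\ UC (2 * delta t) (delta t.+1 / 2)].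
Proof.
move=> exUC monoUC; elim: n e => [|n IH] e e0.
  by exists (fun=> e); split.
have e20 : 0 < e / 2 by rewrite divr_gt0.
have [d d0 dP] := exUC _ e20.
(* Arguments at this level will differ by up to [2 * delta n], hence [d / 2]; the minimum with [e]
   keeps the sequence increasing. *)
have d20 : 0 < Num.min e (d / 2) by rewrite lt_min e0 divr_gt0.
have [delta [deltan delta0 deltaS]] := IH _ d20.
exists (fun t => if (t <= n)%N then delta t else e); split.
- by rewrite ltnn.
- by move=> t _; case: ifP => // tn; exact: delta0.
- move=> t; rewrite ltnS => tn; rewrite tn; case: ltnP => [lt|le]; first exact: deltaS.
  have -> : t = n by apply/eqP; rewrite eqn_leq tn.
  move: deltan; rewrite le_min => /andP[? le2]; split => //.
  by apply: monoUC dP; rewrite mulrC -ler_pdivlMr.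
Qed.

Lemma bary_dist_le1 (R : realType) (K : complex) (b c : realization R K) v :
  `|bary b v - bary c v| <= 1.
Proof.
have := bary_ge0 b v; have := bary_ge0 c v; have := bary_le1 b v; have := bary_le1 c v.
by rewrite ler_norml => *; apply/andP; split; lra.
Qed.

Lemma code_cons_gt a s : (s < code_cons a s)%N.
Proof. by rewrite /code_cons; have : (0 < 2 ^ a)%N; [rewrite expn_gt0|nia]. Qed.

Lemma point_ex (R : realType) (K : complex) N x : (0 < N)%N -> is_point (complex_code K) N x ->
  exists b : realization R K, forall v, (v < complex_code K)%N ->
    N%:R * bary b v = (code_nth x v)%:R.
Proof.
move=> N0 /and3P[_ /eqP xN /exists_ltP[s _ /andP[ks /forall_ltP supp]]].
have NR : N%:R != 0 :> R by rewrite pnatr_eq0 -lt0n.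
have [|||b bE] := @realization_ex R K (fun v => (code_nth x v)%:R / N%:R) s ks.
- by move=> v; rewrite divr_ge0.
- by rewrite -mulr_suml -natr_sum -/(sum_lt _ (code_nth x)) xN mulfV.
- move=> v vk xv; apply: (implyP (supp v vk)); rewrite lt0n.
  by apply: contraTneq xv => ->; rewrite mul0r ltxx.
- by exists b => v vk; rewrite bE // mulrC divfK.
Qed.

Lemma natr_le_truncn (R : realType) (a b : nat) (x : R) :
  0 <= x -> a%:R - b%:R <= x -> (a <= b + Num.truncn x)%N.
Proof.
move=> x0 abx; rewrite -leq_subLR truncn_ge_nat //.
have [ab|ba] := leqP a b; first by rewrite (eqP ab).
by rewrite natrB // ltnW.
Qed.

Lemma ler_norm_scaled (R : realType) (N : nat) (x y r : R) (a b d : nat) : (0 < N)%N ->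
  N%:R * x = a%:R -> N%:R * y = b%:R -> (a <= b + d)%N -> (b <= a + d)%N ->
  d%:R <= N%:R * r -> `|x - y| <= r.
Proof.
move=> N0 xa yb ab ba dr; have NR : 0 < N%:R :> R by rewrite ltr0n.
rewrite -(ler_pM2l NR) -{1}[N%:R]ger0_norm // -normrM mulrBr xa yb.
apply: le_trans dr; rewrite ler_norml; move: ab ba; rewrite -!(ler_nat R) !natrD.
by move=> ? ?; apply/andP; split; lra.
Qed.

(** The error budget of one application: half of [D] for the variation of the operation, a quarter
    for rounding each of the two values. *)
Lemma round_diff (R : realType) (n a b x y c D : R) : 0 <= n ->
  `|n * a - x| <= c -> `|n * b - y| <= c -> `|a - b| <= D / 2 -> c <= n * D / 4 ->
  `|x - y| <= n * D.
Proof.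
move=> n0 ax byc ab cD.
have : `|n * a - n * b| <= n * D / 2.
  by rewrite -mulrBr normrM ger0_norm // -mulrA ler_wpM2l.
by move: ax byc; rewrite !ler_norml => /andP[? ?] /andP[? ?] /andP[? ?]; apply/andP; split; lra.
Qed.

Lemma approx_diff (R : realType) (n a b y c D : R) : 0 <= n ->
  `|a - b| <= D / 2 -> `|n * b - y| <= c -> c <= n * D / 4 -> 0 <= D ->
  `|n * a - y| <= n * D.
Proof.
move=> n0 ab byc cD D0; have nD : 0 <= n * D by rewrite mulr_ge0.
have : `|n * a - n * b| <= n * D / 2.
  by rewrite -mulrBr normrM ger0_norm // -mulrA ler_wpM2l.
by move: byc; rewrite !ler_norml => /andP[? ?] /andP[? ?]; apply/andP; split; lra.
Qed.

(** The left base is at most [n * (u + 4 * D)] with [u] the distance of [s] and [t]: [2 * D] from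
    the two values and [2 * D] from [2 * m]. As [u] and [D] are at most 1, squaring adds at most
    [8 * D + 16 * D]. *)
Lemma distance_square (R : realType) (n s t x y ds dt D m : R) : 0 <= n ->
  `|n * s - x| <= n * ds -> `|n * t - y| <= n * dt -> ds <= D -> dt <= D ->
  0 <= m -> m <= n * D -> `|s - t| <= 1 -> 0 <= D -> D <= 1 ->
  (`|x - y| + 2 * m) ^+ 2 <= n ^+ 2 * ((s - t) ^+ 2 + 24 * D).
Proof.
move=> n0 sx ty dsD dtD m0 mD st D0 D1.
have nds : n * ds <= n * D by rewrite ler_wpM2l.
have ndt : n * dt <= n * D by rewrite ler_wpM2l.
have le : `|x - y| + 2 * m <= n * (`|s - t| + 4 * D).
  have : `|x - y| <= n * `|s - t| + 2 * (n * D).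
    have nst : n * `|s - t| = `|n * s - n * t| by rewrite -mulrBr normrM ger0_norm.
    rewrite nst; have := ler_norm (n * s - n * t); have := ler_norm (n * t - n * s).
    rewrite (distrC (n * t) (n * s)); move: sx ty.
    by rewrite ler_norml [_ <= n * dt]ler_norml => /andP[? ?] /andP[? ?] ? ?;
      rewrite ler_norml; apply/andP; split; lra.
  by rewrite mulrDr; lra.
rewrite (@le_trans _ _ ((n * (`|s - t| + 4 * D)) ^+ 2)) //.
  by rewrite ler_pXn2r ?nnegrE // ?addr_ge0 ?mulr_ge0 // addr_ge0 // mulr_ge0.
rewrite exprMn ler_wpM2l ?sqr_ge0 // -[(s - t) ^+ 2]real_normK ?num_real //.
move: st (normr_ge0 (s - t)); set u := `|s - t| => u1 u0.
have uD : u * D <= D by rewrite ler_piMl.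
have DD : D * D <= D by rewrite ler_piMl.
have -> : (u + 4 * D) ^+ 2 = u ^+ 2 + 8 * (u * D) + 16 * (D * D) by ring.
lra.
Qed.

(** * Tables of rounded operations *)

Fixpoint grid_eval ar (g : nat -> nat -> nat) (tm : term ar) (h : nat) : nat :=
  match tm with
  | Var x => code_nth h x
  | App i ts => g i (CodeSeq.code [seq grid_eval g (ts j) h | j <- enum 'I_(ar i)])
  end.

Section Completeness.
Variables (R : realType) (ar : nat -> nat) (K : complex) (Sigma : {fset equation ar}).
Let k := complex_code K.
Let S := fset_code (@equation_code ar) Sigma.
Let A := realization R K.
Variables (F : operations ar A) (N : nat) (delta : nat -> R) (e eta c : R).
Hypothesis N0 : (0 < N)%N.
Hypothesis delta_gt0 : forall t, (t <= S)%N -> 0 < delta t.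
Hypothesis deltaS : forall t, (t < S)%N -> delta t <= delta t.+1.
Hypothesis F_delta : forall t i, (t < S)%N -> (i < S)%N ->
  unif_continuous_at (@F i) (2 * delta t) (delta t.+1 / 2).
Hypothesis F_eta : forall i, (i < S)%N -> unif_continuous_at (@F i) eta (e / 2).
Hypothesis e_gt0 : 0 < e.
Hypothesis c_delta : c <= N%:R * delta 0 / 4.
Hypothesis N_delta : (k + 1)%:R <= N%:R * delta 0.
Hypothesis N_eta : (2 * k + 1)%:R <= N%:R * eta.

Variables (pt : nat -> A) (g : nat -> nat -> nat).
Hypothesis ptP : forall x, is_point k N x ->
  forall v, (v < k)%N -> N%:R * bary (pt x) v = (code_nth x v)%:R.
Hypothesis g_point : forall i h, is_point k N (g i h).
Hypothesis g_approx : forall i h, approx N c (@F i (fun j => pt (code_nth h j))) (g i h).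
Hypothesis g_supp : forall i h v, (v < k)%N -> (0 < code_nth (g i h) v)%N ->
  e < bary (@F i (fun j => pt (code_nth h j))) v.

Variables f E M W : nat.
Hypothesis fE : forall i h, (i < S)%N -> (h < tuple_bound k N (ar i))%N ->
  code_nth (code_nth f i) h = g i h.
Hypothesis EE : forall (tm : term ar) h, (term_code tm < S)%N -> (h < tuple_bound k N S)%N ->
  code_nth (code_nth E (term_code tm)) h = grid_eval g tm h.
Hypothesis ME : forall t, (t <= S)%N -> code_nth M t = Num.truncn (N%:R * delta t).
Hypothesis WE : forall t, (t < S)%N ->
  (0 < code_nth W t)%N = `[< exists tm : term ar, term_code tm = t >].

Let NR : 0 < N%:R :> R. Proof. by rewrite ltr0n. Qed.

Let delta_mono s t : (s <= t)%N -> (t <= S)%N -> delta s <= delta t.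
Proof.
elim: t => [|t IH]; first by rewrite leqn0 => /eqP ->.
rewrite leq_eqVlt ltnS => /orP[/eqP -> //|st tS].
exact: le_trans (IH st (ltnW tS)) (deltaS tS).
Qed.

Let Ndelta_ge0 t : (t <= S)%N -> 0 <= N%:R * delta t.
Proof. by move=> tS; rewrite mulr_ge0 // ltW // delta_gt0. Qed.

Let M_le t : (t <= S)%N -> (code_nth M t)%:R <= N%:R * delta t.
Proof. by move=> tS; rewrite ME // -truncn_ge_nat ?Ndelta_ge0. Qed.

Let c_le t : (t < S)%N -> c <= N%:R * delta t.+1 / 4.
Proof.
move=> tS; apply: le_trans c_delta _; rewrite ler_wpM2r ?invr_ge0 //.
by rewrite ler_pM2l // delta_mono.
Qed.

Lemma complete_operations : check_operations ar k S N f M.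
Proof.
apply/and3P; split.
- rewrite ME // truncn_ge_nat ?Ndelta_ge0 //; apply: le_trans N_delta.
  by rewrite ler_nat leq_addr.
- apply/forall_ltP => t tS; rewrite !ME //; last exact: ltnW.
  by apply: le_truncn; rewrite ler_pM2l // deltaS.
apply/forall_ltP => i iS; apply/andP; split.
  apply/forall_ltP => h hlt; apply/implyP => ht; rewrite fE // g_point /=.
  (* The common face is the support of the exact value at [h]: a coordinate kept at a nearby [h']
     exceeds [e] there, and so exceeds [e / 2] at [h]. *)
  have [s ks sb] := bary_support (@F i (fun j => pt (code_nth h j))).
  apply/exists_ltP; exists s; first exact: bit_lt.
  rewrite ks; apply/forall_ltP => h' h'lt; apply/implyP => /andP[h't near].
  apply/forall_ltP => v vk; apply/implyP; rewrite fE // sb => /(g_supp vk).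
  have := @F_eta i iS (fun j => pt (code_nth h' j)) (fun j => pt (code_nth h j)) _ v vk.
  have H j w : (w < k)%N -> `|bary (pt (code_nth h' (j : 'I_(ar i)))) w -
      bary (pt (code_nth h j)) w| <= eta.
    move=> wk; have /forall_ltP/(_ _ (ltn_ord j)) hj := ht.
    have /forall_ltP/(_ _ (ltn_ord j)) h'j := h't.
    have /forall_ltP/(_ _ (ltn_ord j))/forall_ltP/(_ _ wk)/andP[? ?] := near.
    exact: ler_norm_scaled N0 (ptP h'j wk) (ptP hj wk) _ _ N_eta.
  move=> /(_ H); move: e_gt0; rewrite ler_norml => ? /andP[? ?] ?; lra.
apply/forall_ltP => t tS; apply/forall_ltP => h hlt; apply/forall_ltP => h' h'lt.
apply/implyP => /and3P[ht h't near]; apply/forall_ltP => v vk.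
rewrite !fE // [code_nth M t.+1]ME //; apply: natr_le_truncn; first exact: Ndelta_ge0.
have := F_delta tS iS (x := fun j => pt (code_nth h j)) (y := fun j => pt (code_nth h' j)).
have H j w : (w < k)%N -> `|bary (pt (code_nth h (j : 'I_(ar i)))) w -
      bary (pt (code_nth h' j)) w| <= 2 * delta t.
  move=> wk; have /forall_ltP/(_ _ (ltn_ord j)) hj := ht.
  have /forall_ltP/(_ _ (ltn_ord j)) h'j := h't.
  have /forall_ltP/(_ _ (ltn_ord j))/forall_ltP/(_ _ wk)/andP[? ?] := near.
  apply: (ler_norm_scaled (d := code_nth M t + k + 1) N0 (ptP hj wk) (ptP h'j wk)) => //.
  (* One share [N * delta t] bounds [M_t], the other the [k + 1] units added in [check_modulus];
     hence the factor 2 in the moduli. *)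
  have -> : N%:R * (2 * delta t) = N%:R * delta t + N%:R * delta t by ring.
  rewrite -addnA natrD lerD ?M_le ?(ltnW tS) //.
  by rewrite (le_trans N_delta) // ler_pM2l // delta_mono // ltnW.
move=> /(_ H v vk) FF; apply: le_trans (ler_norm _) _.
by apply: round_diff (g_approx i h vk) (g_approx i h' vk) FF (c_le tS).
Qed.

Let eval_point (tm : term ar) h : (term_code tm < S)%N -> is_tuple k N S h ->
  is_point k N (grid_eval g tm h).
Proof.
case: tm => [x|i ts] tS ht; last exact: g_point.
exact: (forall_ltP _ _ ht _ (ltn_trans (variable_lt ar x) tS)).
Qed.

Let eval_tuple i (ts : (term ar) ^ (ar i)) h : (term_code (App ts) < S)%N -> is_tuple k N S h ->
  let u := CodeSeq.code [seq grid_eval g (ts j) h | j <- enum 'I_(ar i)] in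
  (u < tuple_bound k N (ar i))%N /\ is_tuple k N (ar i) u.
Proof.
move=> tS ht u; have tjS (j : 'I_(ar i)) := ltn_trans (subterm_code_lt ts j) tS.
split.
  have -> : ar i = size [seq grid_eval g (ts j) h | j <- enum 'I_(ar i)].
    by rewrite size_map size_enum_ord.
  apply: code_lt_bound => a /mapP[j _ ->].
  by have /and3P[/ltnW] := eval_point (tjS j) ht.
apply/forall_ltP => j ji.
rewrite code_nth_code (nth_enum_ord (fun j => grid_eval g (ts j) h) (Ordinal ji)).
exact: eval_point.
Qed.

Lemma complete_terms : check_terms ar k S N f W E.
Proof.
apply/forall_ltP => t tS; apply/implyP; rewrite WE // => /asboolP[tm tmt].
move: tS; rewrite -tmt => {t tmt} tS; apply/orP; case: tm tS => [x|i ts] tS; [left|right].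
  apply/exists_ltP; exists x; first exact: variable_lt.
  rewrite term_code_Var eqxx /= -(term_code_Var ar).
  by apply/forall_ltP => h hlt; apply/implyP => ht; rewrite EE.
apply/exists_ltP; exists i; first exact: symbol_lt.
set s := CodeSeq.code [seq term_code (ts j) | j <- enum 'I_(ar i)].
have sE (j : 'I_(ar i)) : code_nth s j = term_code (ts j).
  by rewrite code_nth_code nth_enum_ord.
have tjS (j : 'I_(ar i)) := ltn_trans (subterm_code_lt ts j) tS.
apply/exists_ltP; exists s.
  by rewrite term_code_App code_cons_gt.
apply/and4P; split; first by rewrite term_code_App.
- by rewrite code_size_code size_map size_enum_ord.
- apply/forall_ltP => j ji; rewrite (sE (Ordinal ji)) WE //.
  by apply/asboolP; exists (ts (Ordinal ji)).
apply/forall_ltP => h hlt; apply/implyP => ht; have [ult ut] := eval_tuple tS ht.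
apply/exists_ltP; eexists; first exact: ult.
apply/andP; split; last first.
  by rewrite EE // fE //; exact: ltn_trans (symbol_lt ts) tS.
apply/forall_ltP => j ji; rewrite (sE (Ordinal ji)) EE //.
by rewrite code_nth_code (nth_enum_ord (fun j => grid_eval g (ts j) h) (Ordinal ji)).
Qed.

(** Assignments are exact grid points here, so variables carry no error; an application adds the
    rounding of its value, for which [delta] leaves room. *)
Let eval_approx (tm : term ar) h : (term_code tm < S)%N -> is_tuple k N S h ->
  approx N (N%:R * delta (term_code tm)) (term_op F tm (fun j => pt (code_nth h j)))
    (grid_eval g tm h).
Proof.
move=> + ht; elim: tm => [x|i ts IH] tS v vk /=.
  have xS := ltn_trans (variable_lt ar x) tS.
  have xh : is_point k N (code_nth h x) by apply: (forall_ltP _ _ ht).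
  by rewrite (ptP xh vk) subrr normr0 Ndelta_ge0 // ltnW.
have iS := ltn_trans (symbol_lt ts) tS.
set t := term_code (App ts) in tS *.
have t0 : (0 < t)%N := leq_ltn_trans (leq0n i) (symbol_lt ts).
have tS' : (t.-1 < S)%N by rewrite prednK // ltnW.
have [_ ut] := eval_tuple tS ht; set u := CodeSeq.code _ in ut *.
have FF := @F_delta t.-1 i tS' iS (fun j => term_op F (ts j) (fun j => pt (code_nth h j)))
  (fun j => pt (code_nth u j)).
have cD := c_le tS'; rewrite prednK // in FF cD.
apply: approx_diff (FF _ v vk) (g_approx i u vk) cD _ => //; last exact/ltW/delta_gt0/ltnW.
move=> j w wk; have uj : is_point k N (code_nth u j) by apply: (forall_ltP _ _ ut).
have tjt := subterm_code_lt ts j; have tjS := ltn_trans tjt tS.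
have := IH j tjS w wk.
have <- : code_nth u j = grid_eval g (ts j) h.
  by rewrite code_nth_code (nth_enum_ord (fun j => grid_eval g (ts j) h)).
rewrite -(ptP uj wk) -mulrBr normrM ger0_norm // ler_pM2l // => /le_trans; apply.
apply: (@le_trans _ _ (delta t.-1)); first by rewrite delta_mono ?(ltnW tS') // -ltnS prednK.
by rewrite ler_peMl ?ler1n // ltW // delta_gt0 // ltnW.
Qed.

Lemma complete_equations r b :
  (forall e a, e \in Sigma -> mdist (term_op F e.1 a) (term_op F e.2 a) <= b) ->
  delta S <= 1 -> N%:R ^+ 2 * (b ^+ 2 + 24 * k%:R * delta S) <= r%:R ^+ 2 ->
  check_equations k S N W E (code_nth M S) r.
Proof.
move=> le_b D1 le_r.
apply/forall_ltP => z _; apply/implyP => /(bit_fset_code _ _ (@equation_code_inj ar))[eq eS zE].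
have zS : (z < S)%N.
  by apply: bit_lt; apply/bit_fset_code; [exact: equation_code_inj|exists eq].
have sz : (term_code eq.1 < z)%N by rewrite zE; apply: ltn_code_mem; rewrite !inE eqxx.
have tz : (term_code eq.2 < z)%N by rewrite zE; apply: ltn_code_mem; rewrite !inE eqxx orbT.
have sS := ltn_trans sz zS; have tS := ltn_trans tz zS.
apply/exists_ltP; exists (term_code eq.1) => //; apply/exists_ltP; exists (term_code eq.2) => //.
apply/and4P; split; first by rewrite zE equation_codeE.
- by rewrite WE //; apply/asboolP; exists eq.1.
- by rewrite WE //; apply/asboolP; exists eq.2.
apply/forall_ltP => h hlt; apply/implyP => ht; rewrite !EE //.
set a := fun j => pt (code_nth h j).
rewrite -(ler_nat R) natr_sum natrX; apply: le_trans le_r.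
set D := delta S.
(* The squared differences sum to at most [b ^+ 2], and each of the [k] coordinates adds
   [24 * D]. *)
apply: (@le_trans _ _ (\sum_(v < k) N%:R ^+ 2 *
    ((bary (term_op F eq.1 a) v - bary (term_op F eq.2 a) v) ^+ 2 + 24 * D))); last first.
  rewrite -mulr_sumr ler_wpM2l ?sqr_ge0 // big_split /= lerD //.
    rewrite -[leLHS]sqr_sqrtr ?sumr_ge0 // => [|v _]; last exact: sqr_ge0.
    by rewrite -mdist_bary ler_pXn2r ?nnegrE ?mdist_ge0 ?(le_trans _ (le_b eq a eS)) ?mdist_ge0 ?le_b.
  by rewrite sumr_const card_ord -[leLHS]mulr_natl mulrCA mulrA.
apply: ler_sum => v _; rewrite natrX 2!natrD natrM natr_dist.
apply: (@distance_square _ _ _ _ _ _ (delta (term_code eq.1)) (delta (term_code eq.2))) => //.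
- exact: eval_approx.
- exact: eval_approx.
- by rewrite delta_mono // ltnW.
- by rewrite delta_mono // ltnW.
- exact: M_le.
- exact: bary_dist_le1.
- exact/ltW/delta_gt0.
Qed.

End Completeness.

(** * Choice of the certificate *)

Lemma code_table n (G : nat -> nat) :
  exists t, forall j, (j < n)%N -> code_nth t j = G j.
Proof. by exists (CodeSeq.code (mkseq G n)) => j jn; rewrite code_nth_code nth_mkseq. Qed.

Lemma code_table2 n (m : nat -> nat) (G : nat -> nat -> nat) :
  exists t, forall i j, (i < n)%N -> (j < m i)%N -> code_nth (code_nth t i) j = G i j.
Proof.
have /choice[T TP] i := code_table (m i) (G i).
have [t tP] := code_table n T.
by exists t => i j ni mj; rewrite tP // TP.
Qed.

Lemma check_boundE (R : realType) (p q d : nat -> nat) N r n : (0 < N)%N ->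
  check_bound p q d N r n =
  (r%:R / N%:R + 2%:R ^- n < ((p n)%:R - (q n)%:R) / (d n).+1%:R :> R).
Proof.
move=> N0; rewrite /check_bound N0 /= -(ltr_nat R) -[RHS]subr_gt0 -[LHS]subr_gt0.
rewrite !natrM !natrD !natrM !natrX.
set D := (d n).+1%:R; have D0 : 0 < D :> R by rewrite ltr0n.
have NR : 0 < N%:R :> R by rewrite ltr0n.
have P0 : 0 < 2%:R ^+ n :> R by rewrite exprn_gt0.
set P := 2%:R ^+ n in P0 *; set X := (X in (0 < X) = _).
have -> : ((p n)%:R - (q n)%:R) / D - (r%:R / N%:R + P^-1) = X / (N%:R * P * D).
  by rewrite /X; field; rewrite !gt_eqF.
by rewrite pmulr_lgt0 // invr_gt0 !mulr_gt0.
Qed.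

Lemma check_bound_sound (R : realType) (alpha : R) (p q d : nat -> nat) N r n :
  `|alpha - ((p n)%:R - (q n)%:R) / (d n).+1%:R| <= 2%:R ^- n ->
  check_bound p q d N r n -> r%:R / N%:R < alpha.
Proof.
move=> H cb; have N0 : (0 < N)%N by case/andP: cb.
move: cb H; rewrite (@check_boundE R) //; set x := (_ / (d n).+1%:R).
by rewrite ler_norml => ? /andP[? _]; lra.
Qed.

Lemma check_bound_complete (R : realType) (alpha : R) (p q d : nat -> nat) N r :
  (forall n, `|alpha - ((p n)%:R - (q n)%:R) / (d n).+1%:R| <= 2%:R ^- n) ->
  (0 < N)%N -> r%:R / N%:R < alpha -> exists n, check_bound p q d N r n.
Proof.
(* The precision is lost twice, in the approximation of [alpha] and in the test itself, so [2 ^- n]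
   must be below half the gap. *)
move=> H N0 lt; have gap : 0 < (alpha - r%:R / N%:R) / 2 by rewrite divr_gt0 // subr_gt0.
have [n _ nP] := near_infty_natSinv_expn_lt (PosNum gap).
exists n; rewrite (@check_boundE R) //.
have := nP n (leqnn n); have := H n; set x := (_ / (d n).+1%:R).
by rewrite ler_norml /= div1r => /andP[_ ?] ?; lra.
Qed.

Lemma round_error_le (R : realType) (k n e d : R) :
  0 <= n -> k <= n * (d / 8) -> k * e <= d / 8 -> k * (n * e + 1) <= n * d / 4.
Proof.
move=> n0 kn ke; have nke : n * (k * e) <= n * (d / 8) by rewrite ler_wpM2l.
have -> : k * (n * e + 1) = n * (k * e) + k by ring.
have -> : n * d / 4 = n * (d / 8) + n * (d / 8) by field.
exact: lerD.
Qed.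

Lemma gap_lt (R : realType) (n a g r : R) :
  2 <= n * (a - g) -> r <= n * g + 1 -> r < n * a.
Proof. by rewrite mulrBr => ? ?; lra. Qed.

Lemma completeness (R : realType) (ar p q d : nat -> nat) (alpha b : R) (K : complex)
    (Sigma : {fset equation ar}) (F : operations ar (realization R K)) :
  (forall n, `|alpha - ((p n)%:R - (q n)%:R) / (d n).+1%:R| <= 2%:R ^- n) ->
  (forall i, continuous (F i)) -> 0 <= b -> b < alpha ->
  (forall e a, e \in Sigma -> mdist (term_op F e.1 a) (term_op F e.2 a) <= b) ->
  exists N f W E M r n, check ar p q d (complex_code K)
    (fset_code (@equation_code ar) Sigma) N f W E M r n.
Proof.
move=> approx_alpha Fc b0 b_alpha le_b.
set k := complex_code K; set S := fset_code _ Sigma.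
have kR : 0 < k%:R :> R by rewrite ltr0n complex_code_gt0.
(* The room between [b] and [gamma] absorbs the errors of evaluation, that between [gamma] and
   [alpha] the rounding of [N * gamma] to an integer [r]. *)
pose gamma := (alpha + b) / 2.
have bg : b < gamma by rewrite /gamma; lra.
have ga : gamma < alpha by rewrite /gamma; lra.
(* The second bound ensures [b ^+ 2 + 24 * k * delta S <= gamma ^+ 2], as required by
   [complete_equations]. *)
have D0 : 0 < Num.min 1 ((gamma ^+ 2 - b ^+ 2) / (24 * k%:R)).
  rewrite lt_min ltr01 divr_gt0 ?mulr_gt0 // subr_gt0 ltr_pXn2r ?nnegrE //.
  exact: le_trans b0 (ltW bg).
have [|delta [deltaD delta_gt0 deltaP]] := @modulus_chain R
    (fun d e => forall i, (i < S)%N -> unif_continuous_at (F i) d e) S _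
    (fun e e0 => operations_unif_continuous S Fc e0) _ D0.
  move=> d1 d2 e d21 UC i iS x y xy; apply: UC => // j v vk.
  exact: le_trans (xy j v vk) d21.
have d0 : 0 < delta 0%N by exact: delta_gt0.
(* The bound [1 / 2] gives [k * e < 1], so a coordinate survives the cut-off; [delta 0 / 8] takes
   half of the rounding budget [N * delta 0 / 4]. The cut-off cannot depend on [N], because [eta]
   depends on it and [N] on [eta]. *)
pose e := Num.min (delta 0%N / 8) (1 / 2) / k%:R.
have e0 : 0 < e by rewrite divr_gt0 // lt_min !divr_gt0.
have keE : k%:R * e = Num.min (delta 0%N / 8) (1 / 2) by rewrite mulrC divfK ?gt_eqF.
have [ke_delta ke1] : k%:R * e <= delta 0%N / 8 /\ k%:R * e < 1.
  rewrite keE ge_min lexx; split => //; apply: (@le_lt_trans _ _ (1 / 2)); last by lra.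
  by rewrite ge_min lexx orbT.
have e20 : 0 < e / 2 by rewrite divr_gt0.
have [eta eta0 etaP] := operations_unif_continuous S Fc e20.
(* Every length that has to span several grid steps is at least [nu]; none needs more than
   [2 * k + 2] steps. *)
pose nu := Num.min (Num.min eta (delta 0%N / 8)) (alpha - gamma).
have nu0 : 0 < nu by rewrite !lt_min eta0 divr_gt0 //= subr_gt0.
have [N N0 N_nu] : exists2 N : nat, (0 < N)%N & (2 * k + 2)%:R <= N%:R * nu.
  have x0 : 0 <= (2 * k + 2)%:R / nu by rewrite divr_ge0 // ltW.
  exists (Num.truncn ((2 * k + 2)%:R / nu)).+1 => //.
  by rewrite -ler_pdivrMr //; have /andP[_ /ltW] := truncn_itv x0.
have NR : 0 < N%:R :> R by rewrite ltr0n.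
have le_nu (x : R) m : nu <= x -> (m <= 2 * k + 2)%N -> m%:R <= N%:R * x.
  move=> nux mk; apply: (@le_trans _ _ (2 * k + 2)%:R); first by rewrite ler_nat.
  by apply: le_trans N_nu _; rewrite ler_pM2l.
have nu_eta : nu <= eta by rewrite !ge_min lexx.
have nu_delta : nu <= delta 0%N / 8 by rewrite !ge_min lexx orbT.
have nu_gap : nu <= alpha - gamma by rewrite ge_min lexx orbT.
pose c := k%:R * (N%:R * e + 1).
have cD : c <= N%:R * delta 0%N / 4.
  have k2 : (k <= 2 * k + 2)%N by rewrite mulSn -addnA leq_addr.
  exact: round_error_le (ltW NR) (le_nu _ k nu_delta k2) ke_delta.
have /choice[pt ptP] : forall x, exists b : realization R K, is_point k N x ->
    forall v, (v < k)%N -> N%:R * bary b v = (code_nth x v)%:R.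
  move=> x; have [xp|_] := boolP (is_point k N x).
    by have [b' bP] := @point_ex R K N x N0 xp; exists b'.
  by have [b'] := realization_inhabited R K; exists b'.
have /choice[g gP] : forall ih : nat * nat, exists x, [/\ is_point k N x,
    approx N c (F ih.1 (fun j => pt (code_nth ih.2 j))) x &
    forall v, (v < k)%N -> (0 < code_nth x v)%N ->
      e < bary (F ih.1 (fun j => pt (code_nth ih.2 j))) v].
  by move=> [i h]; exact: round_ex (ltW e0) ke1.
(* The table [E] is indexed by all numbers below [S]; those coding no term are left unmarked and get
   an arbitrary row. *)
have /choice[dec decP] : forall t, exists tm : term ar,
    (exists tm' : term ar, term_code tm' = t) -> term_code tm = t.
  move=> t; have [[tm tmt]|nt] := pselect (exists tm : term ar, term_code tm = t).
    by exists tm.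
  by exists (Var ar 0) => /nt.
have [f fE] := code_table2 S (fun i => tuple_bound k N (ar i)) (fun i h => g (i, h)).
have [E EP] := code_table2 S (fun=> tuple_bound k N S)
  (fun t => grid_eval (fun i h => g (i, h)) (dec t)).
have EE (tm : term ar) h : (term_code tm < S)%N -> (h < tuple_bound k N S)%N ->
    code_nth (code_nth E (term_code tm)) h = grid_eval (fun i h => g (i, h)) tm h.
  move=> tS hlt; rewrite EP //; congr grid_eval.
  by apply: term_code_inj; apply: decP; exists tm.
have [M ME] := code_table S.+1 (fun t => Num.truncn (N%:R * delta t)).
have [W WP] := code_table S (fun t => `[< exists tm : term ar, term_code tm = t >]).
have WE t : (t < S)%N -> (0 < code_nth W t)%N = `[< exists tm : term ar, term_code tm = t >].
  by move=> tS; rewrite WP // lt0b.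
have Ng0 : 0 <= N%:R * gamma by rewrite mulr_ge0 // (le_trans b0) // ltW.
have [r r_le lt_r] : exists2 r : nat, r%:R <= N%:R * gamma + 1 & N%:R * gamma <= r%:R.
  have /andP[le lt] := truncn_itv Ng0.
  by exists (Num.truncn (N%:R * gamma)).+1; [rewrite -natr1 lerD2r|exact: ltW].
have r_alpha : r%:R / N%:R < alpha.
  rewrite ltr_pdivrMr // mulrC.
  exact: gap_lt (le_nu _ 2%N nu_gap (leq_addl _ _)) r_le.
have [n bound] := check_bound_complete approx_alpha N0 r_alpha.
have g_point i h : is_point k N (g (i, h)) by have [] := gP (i, h).
have g_approx i h : approx N c (F i (fun j => pt (code_nth h j))) (g (i, h)).
  by have [] := gP (i, h).
have g_supp i h v : (v < k)%N -> (0 < code_nth (g (i, h)) v)%N ->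
  e < bary (F i (fun j => pt (code_nth h j))) v by have [_ _] := gP (i, h); apply.
have deltaS t : (t < S)%N -> delta t <= delta t.+1 by move=> /deltaP[].
have F_delta t i : (t < S)%N -> (i < S)%N ->
  unif_continuous_at (F i) (2 * delta t) (delta t.+1 / 2) by move=> /deltaP[_]; apply.
have N_eta : (2 * k + 1)%:R <= N%:R * eta by apply: le_nu; rewrite // leq_add2l.
have N_delta : (k + 1)%:R <= N%:R * delta 0%N.
  apply: le_nu; last by rewrite leq_add // mulSn leq_addr.
  by rewrite (le_trans nu_delta) // ler_pdivrMr // ler_peMr ?ler1n // ltW.
exists N, f, W, E, M, r, n; apply/and5P; split => //.
- exact: check_complex_code.
- apply: (complete_operations N0 delta_gt0 deltaS F_delta etaP e0 cD N_delta N_eta ptP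
    g_point g_approx g_supp fE ME).
- apply: (complete_terms g_point fE EE WE).
- have S24 : 24 * k%:R * delta S <= gamma ^+ 2 - b ^+ 2.
    rewrite mulrC -ler_pdivlMr ?mulr_gt0 //.
    by apply: le_trans deltaD _; rewrite ge_min lexx orbT.
  apply: (complete_equations N0 delta_gt0 deltaS F_delta cD ptP g_point g_approx EE ME WE le_b).
    by apply: le_trans deltaD _; rewrite ge_min lexx.
  apply: (@le_trans _ _ ((N%:R * gamma) ^+ 2)); last by rewrite ler_pXn2r ?nnegrE.
  by rewrite exprMn ler_wpM2l ?sqr_ge0 // -lerBrDl.
Qed.

Lemma completeness_code (R : realType) (ar p q d : nat -> nat) (alpha : R) (K : complex)
    (Sigma : {fset equation ar}) :
  (forall n, `|alpha - ((p n)%:R - (q n)%:R) / (d n).+1%:R| <= 2%:R ^- n) ->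
  (lambda (realization R K) Sigma < alpha%:E)%E ->
  exists2 c, check_code ar p q d c & code_nth c 0 = complex_code K /\
    code_nth c 1 = fset_code (@equation_code ar) Sigma.
Proof.
move=> approx_alpha /ereal_inf_lt[_ [F Fc <-] lt].
have ge0 : (0 <= lambda_algebra F Sigma)%E by apply: ereal_sup_ubound; left.
have lambda_fin : lambda_algebra F Sigma \is a fin_num.
  by apply: fin_real; rewrite (lt_le_trans (ltNyr 0) ge0) (lt_trans lt (ltry _)).
move: lt ge0; rewrite -(fineK lambda_fin) lte_fin lee_fin => lt ge0.
have le_b e a : e \in Sigma ->
    mdist (term_op F e.1 a) (term_op F e.2 a) <= fine (lambda_algebra F Sigma).
  move=> eS; rewrite -lee_fin fineK //; apply: ereal_sup_ubound; right.
  by exists e, a.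
have [N [f [W [E [M [r [n chk]]]]]]] := completeness approx_alpha Fc ge0 lt le_b.
exists (CodeSeq.code [:: complex_code K; fset_code (@equation_code ar) Sigma; N; f; W; E; M; r; n]).
  by rewrite /check_code !code_nth_code.
by rewrite !code_nth_code.
Qed.

(** An arbitrary [c] need not start with codes of a complex and of a set of equations; the checks
    force both, so that only codes of pairs are enumerated. *)
Lemma soundness_code (R : realType) (ar p q d : nat -> nat) (alpha : R) c :
  (forall n, `|alpha - ((p n)%:R - (q n)%:R) / (d n).+1%:R| <= 2%:R ^- n) ->
  check_code ar p q d c -> exists K, exists Sigma : {fset equation ar},
    [/\ complex_code K = code_nth c 0, fset_code (@equation_code ar) Sigma = code_nth c 1 &
      (lambda (realization R K) Sigma < alpha%:E)%E].
Proof.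
move=> approx_alpha /and5P[/complex_code_check[K KE]].
rewrite -KE => opsP termsP eqnsP bound.
have N0 : (0 < code_nth c 2)%N by case/andP: bound.
have [Sigma SE] : exists Sigma : {fset equation ar},
    fset_code (@equation_code ar) Sigma = code_nth c 1.
  apply: fset_code_surj => [|e be]; first exact: equation_code_inj.
  have eS := bit_lt be; have /forall_ltP/(_ e eS)/implyP/(_ be) := eqnsP.
  move=> /exists_ltP[s se /exists_ltP[t te /and4P[/eqP eE Ws Wt _]]].
  have [s' s'E] := checked_term_ex termsP (ltn_trans se eS) Ws.
  have [t' t'E] := checked_term_ex termsP (ltn_trans te eS) Wt.
  by exists (s', t'); rewrite equation_codeE /= s'E t'E.
exists K, Sigma; split => //; rewrite -SE in opsP termsP eqnsP.
have [F Fc Fle] := soundness R N0 opsP termsP eqnsP.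
apply: (@le_lt_trans _ _ (lambda_algebra F Sigma)).
  by apply: ereal_inf_lbound; exists F.
apply: le_lt_trans Fle _; rewrite lte_fin.
exact: check_bound_sound (approx_alpha _) bound.
Qed.

Local Open Scope ereal_scope.

Theorem corollary38 (R : realType) (ar : nat -> nat)
    (ar_recursive : recursive1 ar)
    (ar_infinite : forall n : nat, infinite_set [set i : nat | ar i = n])
    (alpha : R) (alpha_gt0 : (0 < alpha)%R)
    (alpha_computable : computable_real alpha) :
  recursively_enumerable
    [set pair_code p | p in
      [set p : complex * {fset equation ar} |
        lambda (realization R p.1) p.2 < alpha%:E]].
Proof.
have [p [q [d [rp rq rd approx_alpha]]]] := alpha_computable.
have pair_codeE (K : complex) (Sigma : {fset equation ar}) : pair_code (K, Sigma) =
    code_cons (complex_code K) (code_cons (fset_code (@equation_code ar) Sigma) 0).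
  exact: etrans (code_consE _ _) (congr1 _ (code_consE _ _)).
apply: (recursively_enumerable_check
  (out := fun c => code_cons (code_nth c 0) (code_cons (code_nth c 1) 0))
  (rec_check_code ar_recursive rp rq rd)).
- by rec_auto.
- move=> c /(soundness_code approx_alpha)[K [Sigma [<- <- lt]]].
  by exists (K, Sigma).
- move=> _ [[K Sigma] /= lt <-].
  have [c chk [cK cS]] := completeness_code approx_alpha lt.
  by exists c; rewrite // cK cS pair_codeE.
Qed.
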